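(* Let $A$ be an algebra over $A_0=\oplus_{s\in I}\mathbb{C}e_s$ with a fixed choice of types $\mathfrak{t}:I\to\{\pm1\}$, let $\varpi:A\to A$ be a typed anti-involution, and let $\{\!\!\{-,-\}\!\!\}$ be a $\varpi$-typed double bracket on $A$ which is Poisson. Let $\alpha\in\mathbb{N}^I$ be a typed dimension vector, $N=\sum_s\alpha_s$, with corresponding map $\theta$ on $\mathfrak{gl}_N$, $\theta(\xi)=\Theta\xi^T\Theta^T$. Then the antisymmetric biderivation $\{-,-\}_{\varpi,\theta}$ on $\mathrm{Rep}^{\varpi,\theta}(A,\alpha)$ uniquely determined by $$\{a_{ij},b_{kl}\}_{\varpi,\theta}=\tfrac12\{\!\!\{a,b\}\!\!\}_{kj,il}+\tfrac12\,\mathfrak{sgn}_\alpha(\theta(i),\theta(j))\,\{\!\!\{\varpi(a),b\}\!\!\}_{k\theta(i),\theta(j)l},\qquad a,b\in A,\ 1\le i,j,k,l\le N,$$ is a Poisson bracket for which $G:=\prod_{s\in I}G_s$ acts by Poisson automorphisms. Furthermore, if $\mu\in A$ is a moment map for $\{\!\!\{-,-\}\!\!\}$, it can be chosen (up to $\mu\mapsto\mu+c$ with $c\in A_0$) to satisfy $\mu+\varpi(\mu)=0$; then $\mathtt{X}(\mu):\mathrm{Rep}^{\varpi,\theta}(A,\alpha)\to\mathfrak{g}=\prod_s\mathrm{Lie}(G_s)$ is a moment map for $\{-,-\}_{\varpi,\theta}$ after identification of $\mathfrak g$ and its dual (under the trace pairing).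
   Context: Algebras are finitely generated, associative, unital over $\mathbb{C}$; $\otimes=\otimes_{\mathbb{C}}$. $I=\{1,\dots,|I|\}$ is finite, $A_0=\oplus_{s\in I}\mathbb{C}e_s$ with $e_se_t=\delta_{st}e_s$, $\sum_se_s=1$. Double brackets. Write $d=d'\otimes d''\in A\otimes A$; $(d'\otimes d'')^\circ=d''\otimes d'$; $a\,d\,b=ad'\otimes d''b$; $a\ast d\ast b=d'b\otimes ad''$. A double bracket is a $\mathbb{C}$-bilinear map $\{\!\!\{-,-\}\!\!\}:A\times A\to A\otimes A$ with $\{\!\!\{a,b\}\!\!\}=-\{\!\!\{b,a\}\!\!\}^\circ$, $\{\!\!\{a,bc\}\!\!\}=\{\!\!\{a,b\}\!\!\}c+b\{\!\!\{a,c\}\!\!\}$, $\{\!\!\{bc,a\}\!\!\}=\{\!\!\{b,a\}\!\!\}\ast c+b\ast\{\!\!\{c,a\}\!\!\}$, and $\{\!\!\{e,a\}\!\!\}=0=\{\!\!\{a,e\}\!\!\}$ for $e\in A_0$. With $\{\!\!\{a,d\}\!\!\}_L=\{\!\!\{a,d'\}\!\!\}\otimes d''$ and $\tau_{(123)}(a_1\otimes a_2\otimes a_3)=a_3\otimes a_1\otimes a_2$, it is Poisson if $\{\!\!\{a,b,c\}\!\!\}:=\{\!\!\{a,\{\!\!\{b,c\}\!\!\}\}\!\!\}_L+\tau_{(123)}\{\!\!\{b,\{\!\!\{c,a\}\!\!\}\}\!\!\}_L+\tau_{(123)}^2\{\!\!\{c,\{\!\!\{a,b\}\!\!\}\}\!\!\}_L$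 vanishes identically. A moment map is $\mu=\sum_s\mu_s$, $\mu_s\in e_sAe_s$, with $\{\!\!\{\mu_s,a\}\!\!\}=ae_s\otimes e_s-e_s\otimes e_sa$ for all $a\in A$, $s\in I$. Types. A choice of types assigns to each $s\in I$ a type $\mathrm{O}$ ($\mathfrak t(s)=+1$) or $\mathrm{Sp}$ ($\mathfrak t(s)=-1$). A typed anti-involution is a $\mathbb{C}$-linear anti-morphism $\varpi:A\to A$ with $\varpi(e_s)=e_s$ for all $s$ and $\varpi^2(a)=\mathfrak t(s)\mathfrak t(t)a$ for $a\in e_sAe_t$. The double bracket is $\varpi$-typed if $\varpi^{\otimes2}(\{\!\!\{a,b\}\!\!\})=\{\!\!\{\varpi(a),\varpi(b)\}\!\!\}^\circ$ for all $a,b$. A typed dimension vector is $\alpha\in\mathbb{N}^I$ with $\alpha_s$ even whenever $s$ has type $\mathrm{Sp}$. $G_s=\mathrm{O}(\alpha_s)$, $\Theta_s=\mathrm{Id}_{\alpha_s}$ if $s$ has type $\mathrm{O}$; $G_s=\mathrm{Sp}(\alpha_s)$, $\Theta_s=\Omega_{\alpha_s}$ if $s$ has type $\mathrm{Sp}$, where $\Omega_{2d}=\begin{pmatrix}0_d&\mathrm{Id}_d\\-\mathrm{Id}_d&0_d\end{pmatrix}$ and $\mathrm{Sp}(\alpha_s)$ preserves $\Omega_{\alpha_s}$; $\Theta=\mathrm{diag}(\Theta_1,\dots,\Theta_{|I|})$. Index notation. $\mathtt{R}_s=\{\alpha_1+\dots+\alpha_{s-1}+1,\dots,\alpha_1+\dots+\alpha_s\}$;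 $\iota(k)=s$ if $k\in\mathtt{R}_s$. If $\iota(k)$ has type $\mathrm{O}$: $\mathrm{sgn}_\alpha(k)=+1$, $\theta(k)=k$. If $s=\iota(k)$ has type $\mathrm{Sp}$: $\mathrm{sgn}_\alpha(k)=+1$ if $k-\sum_{t<s}\alpha_t\le\alpha_s/2$ and $-1$ otherwise, and $\theta(k)=k+\frac12\mathrm{sgn}_\alpha(k)\alpha_s$. $\mathfrak{sgn}_\alpha(i,j)=\mathfrak t(\iota(i))\,\mathrm{sgn}_\alpha(i)\,\mathfrak t(\iota(j))\,\mathrm{sgn}_\alpha(j)$. Representation spaces. $\mathbb{C}[\mathrm{Rep}(A,\alpha)]$ is the commutative algebra generated by $a_{ij}$ ($a\in A$, $1\le i,j\le N$), linear in $a$, with $(ab)_{ij}=\sum_ra_{ir}b_{rj}$ and $(e_s)_{ij}=\delta_{ij}$ if $i,j\in\mathtt{R}_s$, $0$ otherwise; $\mathtt{X}(a)=(a_{ij})$. $\mathrm{Rep}^{\varpi,\theta}(A,\alpha)=\{\rho\mid\rho\circ\varpi=\theta\circ\rho\}$ is the closed subscheme cut out by the ideal generated by $\varpi(a)_{ij}-\mathfrak{sgn}_\alpha(i,j)\,a_{\theta(j),\theta(i)}$. Notation $(c\otimes d)_{kj,il}=c_{kj}d_{il}$. $G$, embedded block-diagonally in $\mathrm{GL}_N$, acts by $g\cdot\mathtt{X}(a)=g^{-1}\mathtt{X}(a)g$ on coordinate functions, with infinitesimal action $\xi_M(\mathtt{X}(a))=[\mathtt{X}(a),\xi]$, $\xi\in\mathfrak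 g$. A moment map for a $G$-invariant Poisson bracket on $M$ is a $G$-equivariant morphism $\mu:M\to\mathfrak{g}^*$ with $\{\langle\mu,\xi\rangle,-\}=\xi_M$ for all $\xi\in\mathfrak g$; under the trace pairing, $\langle\mathtt{X}(\mu),\xi\rangle=\mathrm{tr}(\mathtt{X}(\mu)\xi)$.
   Formalization: Rep^{ϖ,θ} is taken as cut out by ϖ(a)_ij − sgn_α(i,j)a_{θ(j),θ(i)}, i.e. θ(ξ)=Θ^Tξ^TΘ; the printed θ(ξ)=Θξ^TΘ^T has the opposite sign on blocks joining vertices of different types, where the stated bracket would not be well defined. *)

(* Defs.v *)
From HB Require Import structures.
From mathcomp Require Import all_boot all_order all_algebra.
From mathcomp Require Import generic_quotient ring_quotient.
From mathcomp Require Import boolp finmap monalg.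
From mathcomp Require Export all_boot all_order all_algebra.
From mathcomp Require Export reals complex.

Set Implicit Arguments.
Unset Strict Implicit.
Unset Printing Implicit Defensive.

Import GRing.Theory.
Local Open Scope ring_scope.
Local Open Scope quotient_scope.

Section LinearSpan.
Variables (K : fieldType) (V : lmodType K) (S : V -> Prop).

Inductive lin_span : V -> Prop :=
| LinSpan0 : lin_span 0
| LinSpanS (c : K) (s x : V) : S s -> lin_span x -> lin_span (c *: s + x).

Lemma lin_span_add x y : lin_span x -> lin_span y -> lin_span (x + y).
Proof.
elim=> [|c s {}x Ss _ IH] Hy; first by rewrite add0r.
by rewrite -addrA; apply: LinSpanS => //; apply: IH.
Qed.

Lemma lin_span_scale a x : lin_span x -> lin_span (a *: x).
Proof.
elim=> [|c s {}x Ss _ IH]; first by rewrite scaler0; constructor.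
by rewrite scalerDr scalerA; apply: LinSpanS.
Qed.

Lemma lin_span_gen x : S x -> lin_span x.
Proof. by move=> Sx; rewrite -[x]addr0 -[x]scale1r; apply: LinSpanS => //; constructor. Qed.

Definition lin_span_pred : V -> bool := fun x => `[< lin_span x >].

Lemma lin_span_zmod_closed : zmod_closed lin_span_pred.
Proof.
split=> [|x y]; first by apply/asboolP; constructor.
move=> /asboolP Hx /asboolP Hy; apply/asboolP; apply: lin_span_add => //.
by rewrite -scaleN1r; apply: lin_span_scale.
Qed.

HB.instance Definition _ := GRing.isZmodClosed.Build V lin_span_pred lin_span_zmod_closed.

Definition span_quot := Quotient.quot (GRing.ZmodClosed.clone V lin_span_pred _).
HB.instance Definition _ := GRing.Zmodule.on span_quot.
HB.instance Definition _ := EqQuotient.on span_quot.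

Definition span_pi (x : V) : span_quot := \pi_span_quot x.

Lemma span_pi_eq x y : span_pi x = span_pi y <-> lin_span (x - y).
Proof.
split; first by move/eqP; rewrite /span_pi -Quotient.idealrBE => /asboolP.
by move=> H; apply/eqP; rewrite /span_pi -Quotient.idealrBE; apply/asboolP.
Qed.

Lemma span_pi_repr (x : span_quot) : span_pi (repr x) = x.
Proof. exact: reprK. Qed.

Lemma span_piB : {morph span_pi : x y / x - y}.
Proof. by move=> x y; rewrite /span_pi !piE. Qed.

Lemma span_piD : {morph span_pi : x y / x + y}.
Proof. by move=> x y; rewrite /span_pi !piE. Qed.

Definition span_scale (c : K) (x : span_quot) : span_quot := span_pi (c *: repr x).

Lemma span_scaleE c x : span_scale c (span_pi x) = span_pi (c *: x).
Proof.
apply/span_pi_eq; rewrite -scalerBr; apply: lin_span_scale.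
by apply/span_pi_eq; rewrite span_pi_repr.
Qed.

Fact span_scaleA a b v : span_scale a (span_scale b v) = span_scale (a * b) v.
Proof. by rewrite -[v]span_pi_repr !span_scaleE scalerA. Qed.
Fact span_scale1 : left_id 1 span_scale.
Proof. by move=> v; rewrite -[v]span_pi_repr span_scaleE scale1r. Qed.
Fact span_scaleDr : right_distributive span_scale +%R.
Proof.
move=> a u v; rewrite -[u]span_pi_repr -[v]span_pi_repr.
by rewrite !span_scaleE -!span_piD span_scaleE scalerDr.
Qed.
Fact span_scaleDl v : {morph span_scale^~ v : a b / a + b}.
Proof. by move=> a b; rewrite -[v]span_pi_repr !span_scaleE -span_piD scalerDl. Qed.

HB.instance Definition _ := GRing.Zmodule_isLmodule.Build K span_quot
  span_scaleA span_scale1 span_scaleDr span_scaleDl.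

Lemma span_pi_linear : linear span_pi.
Proof. by move=> a x y; rewrite span_piD -span_scaleE. Qed.
HB.instance Definition _ := GRing.isLinear.Build K V span_quot _ span_pi span_pi_linear.

End LinearSpan.

Section Bilinear.
Variables (K : fieldType) (U V W : lmodType K).
Definition bilinear (f : U -> V -> W) : Prop :=
  (forall v, linear (f^~ v)) /\ (forall u, linear (f u)).
End Bilinear.

Section Tensor.
Variables (K : fieldType) (U V : lmodType K).

Let free := {malg K[(U * V)%type]}.

Inductive tensor_rel : free -> Prop :=
| TensorRelL (a : K) (u u' : U) (v : V) :
    tensor_rel (<< (a *: u + u', v) >> - (a *: << (u, v) >> + << (u', v) >>))
| TensorRelR (a : K) (u : U) (v v' : V) :
    tensor_rel (<< (u, a *: v + v') >> - (a *: << (u, v) >> + << (u, v') >>)).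

Definition tensor := span_quot tensor_rel.
HB.instance Definition _ := GRing.Lmodule.on tensor.

Definition tens (u : U) (v : V) : tensor := span_pi tensor_rel << (u, v) >>.

Lemma tens_bilinear : bilinear tens.
Proof.
split=> [v a u u'|u a v v']; rewrite /tens;
  apply: etrans (span_pi_linear (@tensor_rel) _ _ _); apply/span_pi_eq;
  apply: lin_span_gen; [exact: TensorRelL | exact: TensorRelR].
Qed.

Variable W : lmodType K.

(** For bilinear [f], the linear map with [u (x) v |-> f u v] (junk otherwise). *)
Definition tlift (f : U -> V -> W) (t : tensor) : W :=
  let g : free := repr t in \sum_(p <- msupp g) g@_p *: f p.1 p.2.

End Tensor.
Arguments tens {K U V} u v.
Arguments tlift {K U V W} f t.

Section TensorUniversal.
Variables (K : fieldType) (U V W : lmodType K) (f : U -> V -> W).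

Let ev (g : {malg K[(U * V)%type]}) : W := \sum_(p <- msupp g) g@_p *: f p.1 p.2.

Let evEw (d : {fset U * V}) g : (msupp g `<=` d)%fset ->
  ev g = \sum_(p <- d) g@_p *: f p.1 p.2.
Proof.
move=> le; rewrite /ev; apply: big_fset_incl => // x _ /mcoeff_outdom ->.
by rewrite scale0r.
Qed.

Let ev_linear : linear ev.
Proof.
move=> a g h.
pose d := (msupp g `|` msupp h `|` msupp (a *: g + h))%fset.
have [gd hd kd] : [/\ msupp g `<=` d, msupp h `<=` d & msupp (a *: g + h) `<=` d]%fset.
  by split; rewrite /d; apply/fsubsetP => x xin; rewrite !in_fsetU xin ?orbT.
rewrite (evEw gd) (evEw hd) (evEw kd) scaler_sumr -big_split /=.
by apply: eq_bigr => p _; rewrite mcoeffD mcoeffZ scalerDl scalerA.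
Qed.

Let ev0 : ev 0 = 0.
Proof. by rewrite (evEw (d := fset0)) ?msupp0 // big_seq_fset0. Qed.

Let evB g h : ev (g - h) = ev g - ev h.
Proof. by rewrite addrC -[- h]scaleN1r ev_linear scaleN1r addrC. Qed.

Let evU p : ev << p >> = f p.1 p.2.
Proof. by rewrite (evEw (msuppU_le)) big_seq_fset1 mcoeffUU scale1r. Qed.

Hypothesis fbil : bilinear f.

Let ev_span x : lin_span (@tensor_rel K U V) x -> ev x = 0.
Proof.
case: fbil => fl fr.
elim=> [|c s {}x Ss _ IH]; first exact: ev0.
rewrite ev_linear IH addr0; case: Ss => [a u u' v|a u v v'].
  by rewrite evB ev_linear !evU /= fl subrr scaler0.
by rewrite evB ev_linear !evU /= fr subrr scaler0.
Qed.

Let tlift_pi x : tlift f (span_pi (@tensor_rel K U V) x) = ev x.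
Proof.
rewrite /tlift -/(ev _); apply/eqP; rewrite -subr_eq0 -evB; apply/eqP.
by apply: ev_span; apply/span_pi_eq; rewrite span_pi_repr.
Qed.

Lemma tlift_tens u v : tlift f (tens u v) = f u v.
Proof. by rewrite tlift_pi evU. Qed.

Lemma tlift_linear : linear (tlift f).
Proof.
move=> a x y; rewrite -[x]span_pi_repr -[y]span_pi_repr.
rewrite -(span_pi_linear (@tensor_rel K U V)) !tlift_pi.
exact: ev_linear.
Qed.

End TensorUniversal.

Lemma tensor_span (K : fieldType) (U V : lmodType K) (P : tensor U V -> Prop) :
  P 0 -> (forall c u v x, P x -> P (c *: tens u v + x)) -> forall x, P x.
Proof.
move=> P0 PS x; rewrite -[x]span_pi_repr.
set g := repr x; rewrite [g]monalgE.
elim: (enum_fset (msupp g)) => [|p s IH]; first by rewrite big_nil linear0.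
rewrite big_cons linearD.
have -> : << g@_p *g p >> = g@_p *: << p >> :> {malg K[(U * V)%type]}.
  by apply/malgP => q; rewrite mcoeffZ !mcoeffU mulr_natr.
by rewrite linearZ; case: p => u v; apply: PS.
Qed.

Section TensorMaps.
Variable K : fieldType.

Definition tmap (U V U' V' : lmodType K) (f : U -> U') (g : V -> V')
  : tensor U V -> tensor U' V' := tlift (fun u v => tens (f u) (g v)).

(** [d |-> d^o] *)
Definition tswap (U V : lmodType K) : tensor U V -> tensor V U :=
  tlift (fun u v => tens v u).

(** [a1 (x) a2 (x) a3 |-> a3 (x) a1 (x) a2] *)
Definition tau123 (U : lmodType K) (x : tensor (tensor U U) U)
  : tensor (tensor U U) U :=
  tlift (fun a12 a3 => tlift (fun a1 a2 => tens (tens a3 a1) a2) a12) x.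

End TensorMaps.

Section DoubleBrackets.
Variables (K : fieldType) (A : algType K).

Definition finitely_generated : Prop :=
  exists gens : seq A, forall S : A -> Prop,
    S 1 -> (forall (c : K) x y, S x -> S y -> S (c *: x + y)) ->
    (forall x y, S x -> S y -> S (x * y)) ->
    (forall x, x \in gens -> S x) -> forall x, S x.

(** [a d b = a d' (x) d'' b] and [a * d * b = d' b (x) a d'']. *)
Definition outer_act (a : A) (d : tensor A A) (b : A) : tensor A A :=
  tmap (fun x : A => a * x) (fun y : A => y * b) d.
Definition inner_act (a : A) (d : tensor A A) (b : A) : tensor A A :=
  tmap (fun x : A => x * b) (fun y : A => a * y) d.

Variables (n : nat) (e : 'I_n -> A).

(** The unital morphism [A_0 = (+)_s K e_s -> A]; it need not be injective. *)
Definition idempotent_decomposition : Prop :=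
  (forall s t, e s * e t = if s == t then e s else 0) /\ \sum_s e s = 1.

Definition in_A0 (c : A) : Prop := exists k : 'I_n -> K, c = \sum_s k s *: e s.

Variable dbr : A -> A -> tensor A A.

Record double_bracket : Prop := DoubleBracket {
  dbr_bilinear : bilinear dbr;
  dbr_cyclic_antisym : forall a b, dbr a b = - tswap (dbr b a);
  dbr_outer_leibniz : forall a b c,
    dbr a (b * c) = outer_act 1 (dbr a b) c + outer_act b (dbr a c) 1;
  dbr_inner_leibniz : forall a b c,
    dbr (b * c) a = inner_act 1 (dbr b a) c + inner_act b (dbr c a) 1;
  dbr_A0 : forall c a, in_A0 c -> dbr c a = 0 /\ dbr a c = 0
}.

Definition dbrL (a : A) (d : tensor A A) : tensor (tensor A A) A :=
  tmap (dbr a) (fun y : A => y) d.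

Definition triple_bracket (a b c : A) : tensor (tensor A A) A :=
  dbrL a (dbr b c) + tau123 (dbrL b (dbr c a)) + tau123 (tau123 (dbrL c (dbr a b))).

Definition double_poisson : Prop := forall a b c, triple_bracket a b c = 0.

Definition double_moment_map (mu : A) : Prop :=
  exists mu_ : 'I_n -> A,
    [/\ mu = \sum_s mu_ s,
        forall s, mu_ s = e s * mu_ s * e s &
        forall s a, dbr (mu_ s) a = tens (a * e s) (e s) - tens (e s) (e s * a)].

End DoubleBrackets.

Inductive block_type := TypeO | TypeSp.

Definition is_Sp (t : block_type) : bool := if t is TypeSp then true else false.

Section Types.
Variables (K : fieldType) (A : algType K) (n : nat) (e : 'I_n -> A).
Variable ty : 'I_n -> block_type.

Definition type_sign (t : block_type) : K := (-1) ^+ is_Sp t.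

Record typed_anti_involution (w : A -> A) : Prop := TypedAntiInvolution {
  tai_linear : linear w;
  tai_antimorph : forall a b, w (a * b) = w b * w a;
  tai_idem : forall s, w (e s) = e s;
  tai_square : forall s t a,
    w (w (e s * a * e t)) = (type_sign (ty s) * type_sign (ty t)) *: (e s * a * e t)
}.

Definition typed_double_bracket (w : A -> A) (dbr : A -> A -> tensor A A) : Prop :=
  forall a b, tmap w w (dbr a b) = tswap (dbr (w a) (w b)).

Definition typed_dimension (alpha : 'I_n -> nat) : Prop :=
  forall s, is_Sp (ty s) -> ~~ odd (alpha s).

End Types.

Section Indices.
Variables (K : fieldType) (n : nat) (ty : 'I_n -> block_type) (alpha : 'I_n -> nat).
Let N := (\sum_s alpha s)%N.

(** Indices in ['I_N] start at 0: [tagnat.sig1 k] is the block containing [k],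
    [tagnat.sig2 k] its position inside that block. *)
Definition blk (k : 'I_N) : 'I_n := tagnat.sig1 k.

Definition sgn1 (k : 'I_N) : K :=
  (-1) ^+ (is_Sp (ty (blk k)) && ((alpha (blk k))./2 <= tagnat.sig2 k)%N).

(** [insubd] supplies the bound proof; its default value is never reached when
    [m] is even, and [m] is the size of a block of type Sp. *)
Definition theta_block (t : block_type) (m : nat) (j : 'I_m) : 'I_m :=
  if t is TypeSp then insubd j (if j < m./2 then j + m./2 else j - m./2)%N else j.

Definition theta (k : 'I_N) : 'I_N :=
  tagnat.Rank (blk k) (theta_block (ty (blk k)) (tagnat.sig2 k)).

Definition sgn2 (i j : 'I_N) : K :=
  type_sign K (ty (blk i)) * sgn1 i * (type_sign K (ty (blk j)) * sgn1 j).

End Indices.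

Section Groups.
Variables (K : comPzRingType).

(** [Omega_{2d}], with upper right block [Id_d] and lower left block [- Id_d]. *)
Definition Omega (m : nat) : 'M[K]_m :=
  \matrix_(i, j) ((j == (i + m./2)%N :> nat)%:R - (i == (j + m./2)%N :> nat)%:R).

Definition Theta_block (t : block_type) (m : nat) : 'M[K]_m :=
  if t is TypeSp then Omega m else 1%:M.

Variables (n : nat) (ty : 'I_n -> block_type) (alpha : 'I_n -> nat).
Let N := (\sum_s alpha s)%N.

(** [O(m)] or [Sp(m)], and their Lie algebras (the linearised condition). *)
Definition in_G_block (t : block_type) (m : nat) (g : 'M[K]_m) : Prop :=
  g^T *m Theta_block t m *m g = Theta_block t m.
Definition in_Lie_block (t : block_type) (m : nat) (x : 'M[K]_m) : Prop :=
  x^T *m Theta_block t m + Theta_block t m *m x = 0.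

Definition in_G (g : 'M[K]_N) : Prop :=
  exists g_ : forall s, 'M[K]_(alpha s),
    (forall s, in_G_block (ty s) (g_ s)) /\ g = \mxdiag_s g_ s.
Definition in_Lie (x : 'M[K]_N) : Prop :=
  exists x_ : forall s, 'M[K]_(alpha s),
    (forall s, in_Lie_block (ty s) (x_ s)) /\ x = \mxdiag_s x_ s.

End Groups.

Section IdealQuotient.
Variables (R : comPzRingType) (S : R -> Prop).

Inductive ideal_gen : R -> Prop :=
| IdealGen0 : ideal_gen 0
| IdealGenS (c s x : R) : S s -> ideal_gen x -> ideal_gen (c * s + x).

Lemma ideal_gen_add x y : ideal_gen x -> ideal_gen y -> ideal_gen (x + y).
Proof.
elim=> [|c s {}x Ss _ IH] Hy; first by rewrite add0r.
by rewrite -addrA; apply: IdealGenS => //; apply: IH.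
Qed.

Lemma ideal_gen_mul a x : ideal_gen x -> ideal_gen (a * x).
Proof.
elim=> [|c s {}x Ss _ IH]; first by rewrite mulr0; constructor.
by rewrite mulrDr mulrA; apply: IdealGenS.
Qed.

Lemma ideal_gen_gen x : S x -> ideal_gen x.
Proof. by move=> Sx; rewrite -[x]addr0 -[x]mul1r; apply: IdealGenS => //; constructor. Qed.

Definition ideal_pred : R -> bool := fun x => `[< ideal_gen x >].

Lemma ideal_zmod_closed : zmod_closed ideal_pred.
Proof.
split=> [|x y]; first by apply/asboolP; constructor.
move=> /asboolP Hx /asboolP Hy; apply/asboolP; apply: ideal_gen_add => //.
by rewrite -mulN1r; apply: ideal_gen_mul.
Qed.

HB.instance Definition _ := GRing.isZmodClosed.Build R ideal_pred ideal_zmod_closed.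

Definition ideal_quot := Quotient.quot (GRing.ZmodClosed.clone R ideal_pred _).
HB.instance Definition _ := GRing.Zmodule.on ideal_quot.
HB.instance Definition _ := EqQuotient.on ideal_quot.

Definition ipi (x : R) : ideal_quot := \pi_ideal_quot x.

Lemma ipi_eq x y : ipi x = ipi y <-> ideal_gen (x - y).
Proof.
split; first by move/eqP; rewrite /ipi -Quotient.idealrBE => /asboolP.
by move=> H; apply/eqP; rewrite /ipi -Quotient.idealrBE; apply/asboolP.
Qed.

Lemma ipi_repr (x : ideal_quot) : ipi (repr x) = x.
Proof. exact: reprK. Qed.

Lemma ipiD : {morph ipi : x y / x + y}.
Proof. by move=> x y; rewrite /ipi !piE. Qed.

Definition iq_one : ideal_quot := ipi 1.
Definition iq_mul (x y : ideal_quot) : ideal_quot := ipi (repr x * repr y).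

Lemma iq_mulE x y : iq_mul (ipi x) (ipi y) = ipi (x * y).
Proof.
have Hr z : ideal_gen (repr (ipi z) - z) by apply/ipi_eq; rewrite ipi_repr.
apply/ipi_eq.
set x' := repr _; set y' := repr _.
have -> : x' * y' - x * y = y' * (x' - x) + x * (y' - y).
  by rewrite !mulrBr addrA (mulrC y' x') (mulrC y' x) subrK.
by apply: ideal_gen_add; apply: ideal_gen_mul; apply: Hr.
Qed.

Fact iq_mulA : associative iq_mul.
Proof.
move=> x y z; rewrite -[x]ipi_repr -[y]ipi_repr -[z]ipi_repr.
by rewrite !iq_mulE mulrA.
Qed.
Fact iq_mulC : commutative iq_mul.
Proof. by move=> x y; rewrite -[x]ipi_repr -[y]ipi_repr !iq_mulE mulrC. Qed.
Fact iq_mul1 : left_id iq_one iq_mul.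
Proof. by move=> x; rewrite -[x]ipi_repr iq_mulE mul1r. Qed.
Fact iq_mulDl : left_distributive iq_mul +%R.
Proof.
move=> x y z; rewrite -[x]ipi_repr -[y]ipi_repr -[z]ipi_repr.
by rewrite -ipiD !iq_mulE -ipiD mulrDl.
Qed.

HB.instance Definition _ := GRing.Zmodule_isComPzRing.Build ideal_quot
  iq_mulA iq_mulC iq_mul1 iq_mulDl.

Lemma ipi_zmod_morphism : zmod_morphism ipi.
Proof. by move=> x y; rewrite /ipi !piE. Qed.
Lemma ipi_monoid_morphism : monoid_morphism ipi.
Proof. by split=> // x y; rewrite -iq_mulE. Qed.
HB.instance Definition _ := GRing.isZmodMorphism.Build R ideal_quot ipi ipi_zmod_morphism.
HB.instance Definition _ := GRing.isMonoidMorphism.Build R ideal_quot ipi ipi_monoid_morphism.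

End IdealQuotient.

Section RepSpaces.
Variables (K : fieldType) (A : algType K) (n : nat) (e : 'I_n -> A).
Variables (alpha : 'I_n -> nat).
Let N := (\sum_s alpha s)%N.

(** Polynomial ring on the symbols [(a, i, j)]. *)
Definition rep_free := {malg K[{cmonom (A * 'I_N * 'I_N)%type}]}.
HB.instance Definition _ := GRing.ComAlgebra.on rep_free.

Definition rep_var (a : A) (i j : 'I_N) : rep_free := << ucm (a, i, j) >>.

Inductive rep_rel : rep_free -> Prop :=
| RepRelLin (c : K) (a b : A) (i j : 'I_N) :
    rep_rel (rep_var (c *: a + b) i j - (c *: rep_var a i j + rep_var b i j))
| RepRelMul (a b : A) (i j : 'I_N) :
    rep_rel (rep_var (a * b) i j - \sum_r rep_var a i r * rep_var b r j)
| RepRelIdem (s : 'I_n) (i j : 'I_N) :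
    rep_rel (rep_var (e s) i j - ((blk i == s) && (i == j))%:R).

(** [K[Rep(A, alpha)]]; it is the zero ring when the scheme is empty. *)
Definition rep_ring := ideal_quot rep_rel.
HB.instance Definition _ := GRing.ComPzRing.on rep_ring.

Definition rep_coord (a : A) (i j : 'I_N) : rep_ring := ipi rep_rel (rep_var a i j).
Definition rep_cst (c : K) : rep_ring := ipi rep_rel (c *: 1).

Variables (ty : 'I_n -> block_type) (w : A -> A).

(** The map [xi |-> (sgn2 i j * xi (theta j) (theta i))_{i,j}] is
    [xi |-> Theta^T xi^T Theta]. On blocks [(s, t)] with [ty s <> ty t] it is the
    opposite of [Theta xi^T Theta^T]; the bracket [rep_bracket_formula] descends
    to the quotient for the sign used here. *)
Inductive trep_rel : rep_ring -> Prop :=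
| TRepRel (a : A) (i j : 'I_N) :
    trep_rel (rep_coord (w a) i j -
              rep_cst (sgn2 K ty i j) * rep_coord a (theta ty j) (theta ty i)).

(** Coordinate ring of [Rep^{w, theta}(A, alpha)]. *)
Definition trep_ring := ideal_quot trep_rel.
HB.instance Definition _ := GRing.ComPzRing.on trep_ring.

Definition trep_cst (c : K) : trep_ring := ipi trep_rel (rep_cst c).

Lemma trep_cst_zmod_morphism : zmod_morphism trep_cst.
Proof. by move=> x y; rewrite /trep_cst /rep_cst scalerBl !rmorphB. Qed.
Lemma trep_cst_monoid_morphism : monoid_morphism trep_cst.
Proof.
split=> [|x y]; rewrite /trep_cst /rep_cst ?scale1r ?rmorph1 //.
by rewrite -!rmorphM -scalerAl mul1r scalerA.
Qed.
HB.instance Definition _ := GRing.isZmodMorphism.Build K trep_ring trep_cst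
  trep_cst_zmod_morphism.
HB.instance Definition _ := GRing.isMonoidMorphism.Build K trep_ring trep_cst
  trep_cst_monoid_morphism.

Definition trep_scale (c : K) (x : trep_ring) : trep_ring := trep_cst c * x.
Fact trep_scaleA a b v : trep_scale a (trep_scale b v) = trep_scale (a * b) v.
Proof. by rewrite /trep_scale trep_cst_monoid_morphism.2 mulrA. Qed.
Fact trep_scale1 : left_id 1 trep_scale.
Proof. by move=> v; rewrite /trep_scale trep_cst_monoid_morphism.1 mul1r. Qed.
Fact trep_scaleDr : right_distributive trep_scale +%R.
Proof. by move=> a u v; rewrite /trep_scale mulrDr. Qed.
Fact trep_scaleDl v : {morph trep_scale^~ v : a b / a + b}.
Proof. by move=> a b; rewrite /trep_scale rmorphD mulrDl. Qed.
HB.instance Definition _ := GRing.Zmodule_isLmodule.Build K trep_ring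
  trep_scaleA trep_scale1 trep_scaleDr trep_scaleDl.

(** The generic matrix [X(a)] on [Rep^{w, theta}(A, alpha)]. *)
Definition trep_X (a : A) : 'M[trep_ring]_N :=
  \matrix_(i, j) ipi trep_rel (rep_coord a i j).

(** [d_{kj,il}], where [(c (x) d)_{kj,il} = c_{kj} d_{il}]. *)
Definition tensor_coord (d : tensor A A) (k j i l : 'I_N) : trep_ring :=
  tlift (fun c d => trep_X c k j * trep_X d i l) d.

Record antisym_biderivation (pb : trep_ring -> trep_ring -> trep_ring) : Prop :=
  AntisymBiderivation {
  pb_bilinear : bilinear pb;
  pb_antisym : forall x y, pb x y = - pb y x;
  pb_leibniz : forall x y z, pb x (y * z) = pb x y * z + y * pb x z
}.

Definition jacobi_identity (pb : trep_ring -> trep_ring -> trep_ring) : Prop :=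
  forall x y z, pb x (pb y z) + pb y (pb z x) + pb z (pb x y) = 0.

Definition poisson_bracket pb : Prop := antisym_biderivation pb /\ jacobi_identity pb.

Definition rep_bracket_formula (dbr : A -> A -> tensor A A)
    (pb : trep_ring -> trep_ring -> trep_ring) : Prop :=
  forall (a b : A) (i j k l : 'I_N),
    pb (trep_X a i j) (trep_X b k l) =
      2%:R^-1 *: tensor_coord (dbr a b) k j i l +
      (2%:R^-1 * sgn2 K ty (theta ty i) (theta ty j)) *:
        tensor_coord (dbr (w a) b) k (theta ty i) (theta ty j) l.

Definition cst_mx (x : 'M[K]_N) : 'M[trep_ring]_N := map_mx trep_cst x.

(** [act] is only meaningful on elements of [G]. *)
Record G_action (act : 'M[K]_N -> trep_ring -> trep_ring) : Prop := GAction {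
  act_linear : forall g, in_G ty g -> linear (act g);
  act_monoid : forall g, in_G ty g -> monoid_morphism (act g);
  act_id : forall x, act 1%:M x = x;
  act_mul : forall g h, in_G ty g -> in_G ty h ->
    forall x, act (g *m h) x = act g (act h x);
  act_X : forall g, in_G ty g -> forall a i j,
    act g (trep_X a i j) = (cst_mx (invmx g) *m trep_X a *m cst_mx g) i j
}.

Definition G_invariant act (pb : trep_ring -> trep_ring -> trep_ring) : Prop :=
  forall g : 'M[K]_N, in_G ty g ->
    forall x y, act g (pb x y) = pb (act g x) (act g y).

(** [inf xi] is the vector field [xi_M]; only meaningful for [xi] in the Lie algebra. *)
Record infinitesimal_action (inf : 'M[K]_N -> trep_ring -> trep_ring) : Prop :=
  InfinitesimalAction {
  inf_linear : forall xi, in_Lie ty xi -> linear (inf xi);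
  inf_leibniz : forall xi, in_Lie ty xi ->
    forall x y, inf xi (x * y) = inf xi x * y + x * inf xi y;
  inf_X : forall xi, in_Lie ty xi -> forall a i j,
    inf xi (trep_X a i j) = (trep_X a *m cst_mx xi - cst_mx xi *m trep_X a) i j
}.

(** A morphism to the dual of the Lie algebra is given by its comorphism
    [xi |-> <mu, xi>], which is linear on the Lie algebra. Equivariance for the
    coadjoint action reads [g . <mu, xi> = <mu, g xi g^-1>] on functions, since
    [(g . f)(rho) = f(g^-1 . rho)]. *)
Record moment_map (act inf : 'M[K]_N -> trep_ring -> trep_ring)
    (pb : trep_ring -> trep_ring -> trep_ring) (mu : 'M[K]_N -> trep_ring) : Prop :=
  MomentMap {
  mm_linear : forall (c : K) xi eta, in_Lie ty xi -> in_Lie ty eta ->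
    mu (c *: xi + eta) = c *: mu xi + mu eta;
  mm_equivariant : forall g xi, in_G ty g -> in_Lie ty xi ->
    act g (mu xi) = mu (g *m xi *m invmx g);
  mm_hamiltonian : forall xi, in_Lie ty xi -> forall x, pb (mu xi) x = inf xi x
}.

(** [xi |-> tr(m xi)] *)
Definition trace_pairing (m : 'M[trep_ring]_N) (xi : 'M[K]_N) : trep_ring :=
  \tr (m *m cst_mx xi).

End RepSpaces.

(* Main.v *)
From HB Require Import structures.
From mathcomp Require Import all_boot all_order all_algebra.
From mathcomp Require Import generic_quotient boolp classical_sets finmap monalg.
From mathcomp Require Import ring zify.
Require Import Defs.

Set Implicit Arguments.
Unset Strict Implicit.
Unset Printing Implicit Defensive.

Import GRing.Theory.
Local Open Scope ring_scope.

(** Van den Bergh's formula [{a_ij, b_kl} = {{a, b}}_{kj,il}] defines a Poisson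
    bracket on the coordinate ring [R] of Rep(A, alpha), whose Jacobiator is the
    difference of two evaluations of the triple bracket. The typed anti-involution
    [w] and [Theta] induce an involution [sigma] of [R],
    [X(a) |-> Theta X(w a)^T Theta^T], which is Poisson because the double bracket
    is typed, and the typed representation space is the fixed locus of [sigma]: its
    ideal is generated by elements [u - sigma u]. Dirac reduction applies: on the
    quotient, the bracket of the classes of [f] and [g] is the class of
    [{(f + sigma f)/2, g}], and the Jacobi identity is inherited by lifting to
    [sigma]-invariant functions. Conjugation by [G], its infinitesimal action, and the
    Hamiltonians [tr(X(mu) xi)] live on [R], commute with [sigma] (are fixed by it),
    and descend.

    If [mu = sum_s mu_s] is a moment map, so is [- w mu]; hence
    [nu_s = mu_s + w mu_s] has zero bracket with [mu_s], which by the moment map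
    property says [nu_s (x) e_s = e_s (x) nu_s], so [nu_s] is a multiple of [e_s] and
    [mu] can be shifted by [- (1/2) sum_s nu_s]. *)

(** Averaging over [sigma] is linear but not multiplicative, so [{(f + sigma f)/2, g}] is visibly
    neither antisymmetric nor a derivation in [f]. The bracket laws are therefore checked on
    [sigma]-invariant lifts, where the bracket is just the class of [{f, g}]. The factor 1/2 of the
    stated formula is this averaging, and its second term is the bracket with [sigma a_ij], carrying
    the sign that [sigma] puts on that coordinate. Since [tr(X(mu) xi)] is already invariant, no
    factor 1/2 survives in the moment map condition. Two sign conventions have to meet: on blocks of
    different types [Theta M^T Theta^T] is the opposite of [Theta^T M^T Theta], so transposing twice
    by [Theta] is the identity only up to type signs. The twist in [w^2] supplies exactly these
    signs. No coordinate ring is assumed nonzero, because the scheme may be empty, and an idempotent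
    [e s] may vanish. *)

Lemma rmorphism_intro (R S : pzRingType) (f : R -> S) :
  zmod_morphism f -> monoid_morphism f -> exists g : {rmorphism R -> S}, g =1 f.
Proof.
move=> fB fM.
by exists (HB.pack_for {rmorphism R -> S} f (GRing.isZmodMorphism.Build _ _ f fB)
  (GRing.isMonoidMorphism.Build _ _ f fM)).
Qed.

(** * Universal properties of polynomial rings and quotient rings; dual numbers *)

Section PolynomialRing.
Variables (K : comNzRingType) (I : choiceType).
Let F := {malg K[{cmonom I}]}.

Lemma malg_scale1 c : c *: 1 = << c *g mone >> :> F.
Proof. by rewrite -mul_malgC mulr1. Qed.

(** Monomials are treated by induction on the degree: a monomial other than 1 contains a variable,
    and dividing it out lowers the degree. *)
Lemma malg_poly_ind (P : F -> Prop) :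
  (forall c, P (c *: 1)) -> (forall i, P << ucm i >>) ->
  (forall x y, P x -> P y -> P (x + y)) -> (forall x y, P x -> P y -> P (x * y)) ->
  forall x, P x.
Proof.
move=> Pc Pv PD PM x.
have P0 : P 0 by rewrite -(scale0r 1).
have Pm (m : {cmonom I}) : P << m >>.
  have [k] := ubnP (mdeg m); elim: k m => // k IH m.
  have [->|] := eqVneq m mone; first by move=> _; have := Pc 1; rewrite scale1r.
  rewrite -mdeg_eq0 => m_neq0 le_mk.
  have [i mi] : exists i, i \in finsupp m.
    apply/fset0Pn; apply: contraNneq m_neq0 => m0.
    by rewrite mdegE m0 big_seq_fset0.
  have Em : m = mmul (ucm i) (divcm m (ucm i)).
    apply/eqP/cmP => j; rewrite cmM divcmE ucmE.
    by case: eqP => [<-|] /=; rewrite ?subn0 // subnKC // lt0n cmE_neq0.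
  have -> : << m >> = << ucm i >> * << divcm m (ucm i) >> :> F.
    by rewrite malgM_def fgmulUU mulr1 -Em.
  apply: PM => //; apply: IH.
  by move: le_mk; rewrite {1}Em mdegM mdegU add1n ltnS.
rewrite [x]monalgE; elim: (enum_fset _) => [|m s IH]; first by rewrite big_nil.
rewrite big_cons; apply: PD => //.
have -> : << x@_m *g m >> = x@_m *: 1 * << m >> :> F.
  by rewrite malg_scale1 malgM_def fgmulUU mulr1 mul1m.
exact: (PM _ _ (Pc _) (Pm m)).
Qed.

Variables (Q : comPzRingType) (k : {rmorphism K -> Q}) (v : I -> Q).

Let evm (m : {cmonom I}) : Q := \prod_(i <- finsupp m) v i ^+ m i.

Let evmw (m : {cmonom I}) (d : {fset I}) : (finsupp m `<=` d)%fset ->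
  evm m = \prod_(i <- d) v i ^+ m i.
Proof.
move=> le; rewrite /evm; apply: big_fset_incl => // i _.
by rewrite -cmE_eq0 => /eqP ->.
Qed.

Let evmM m1 m2 : evm (mmul m1 m2) = evm m1 * evm m2.
Proof.
rewrite {1}/evm mdomD (evmw (fsubsetUl (finsupp m1) (finsupp m2))).
rewrite (evmw (fsubsetUr (finsupp m1) (finsupp m2))) -big_split /=.
by apply: eq_bigr => i _; rewrite cmM exprD.
Qed.

Let ev (g : F) : Q := \sum_(m <- msupp g) k g@_m * evm m.

Let evw (d : {fset {cmonom I}}) g : (msupp g `<=` d)%fset ->
  ev g = \sum_(m <- d) k g@_m * evm m.
Proof.
move=> le; rewrite /ev; apply: big_fset_incl => // x _ /mcoeff_outdom ->.
by rewrite rmorph0 mul0r.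
Qed.

Let evB : zmod_morphism ev.
Proof.
move=> g h; pose d := (msupp g `|` msupp h)%fset.
rewrite (evw (fsubsetUl (msupp g) (msupp h))) (evw (fsubsetUr (msupp g) (msupp h))).
rewrite (evw (msuppB_le g h)) -sumrB.
by apply: eq_bigr => m _; rewrite mcoeffB rmorphB mulrBl.
Qed.

HB.instance Definition _ := GRing.isZmodMorphism.Build F Q ev evB.

Let evU c m : ev << c *g m >> = k c * evm m.
Proof. by rewrite (evw msuppU_le) big_seq_fset1 mcoeffUU. Qed.

Let evM : monoid_morphism ev.
Proof.
split=> [|g h]; first by rewrite evU rmorph1 mul1r /evm mdom1 big_seq_fset0.
rewrite malgME raddf_sum mulr_suml /=; apply: eq_bigr => i _.
rewrite raddf_sum mulr_sumr /=; apply: eq_bigr => j _.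
by rewrite evU rmorphM evmM mulrACA.
Qed.

Lemma malg_poly_lift :
  exists f : {rmorphism F -> Q}, (forall c, f (c *: 1) = k c) /\
    (forall i, f << ucm i >> = v i).
Proof.
have [f fE] := rmorphism_intro evB evM; exists f; split=> [c|i]; rewrite fE.
  by rewrite malg_scale1 evU /evm mdom1 big_seq_fset0 mulr1.
by rewrite evU rmorph1 mul1r /evm mdomU big_seq_fset1 cmUU expr1.
Qed.

End PolynomialRing.

Section IdealQuotientTheory.
Variables (R : comPzRingType) (S : R -> Prop).

Lemma ipiB : {morph ipi S : x y / x - y}.
Proof. exact: rmorphB. Qed.
Lemma ipiN : {morph ipi S : x / - x}.
Proof. exact: rmorphN. Qed.
Lemma ipiM : {morph ipi S : x y / x * y}.
Proof. exact: rmorphM. Qed.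
Lemma ipi0 : ipi S 0 = 0.
Proof. exact: rmorph0. Qed.
Lemma ipi1 : ipi S 1 = 1.
Proof. exact: rmorph1. Qed.

Lemma ipiP (x : ideal_quot S) : exists y, x = ipi S y.
Proof. by exists (repr x); rewrite ipi_repr. Qed.

Lemma ipi0P x : ipi S x = 0 <-> ideal_gen S x.
Proof. by rewrite -(rmorph0 (ipi S)) ipi_eq subr0. Qed.

(** Stated for additive maps so that it also serves a derivation followed by a projection; vanishing
    on all multiples [c * s] replaces multiplicativity. *)
Lemma ideal_quot_lift (Q : zmodType) (f : R -> Q) : zmod_morphism f ->
  (forall c s, S s -> f (c * s) = 0) ->
  exists g : ideal_quot S -> Q, forall x, g (ipi S x) = f x.
Proof.
move=> fB fS; have f0 : f 0 = 0 by have := fB 0 0; rewrite !subr0 subrr.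
exists (fun x => f (repr x)) => x; apply: subr0_eq; rewrite -fB.
have : ideal_gen S (repr (ipi S x) - x) by apply/ipi_eq; rewrite ipi_repr.
elim=> [//|c s {}x Ss _ fx].
by rewrite -[x]opprK -[- x]sub0r !fB fx fS // f0 !subr0.
Qed.

Lemma ideal_quot_rlift (Q : comPzRingType) (f : {rmorphism R -> Q}) :
  (forall s, S s -> f s = 0) ->
  exists g : {rmorphism ideal_quot S -> Q}, forall x, g (ipi S x) = f x.
Proof.
move=> fS.
have [g gE] : exists g : ideal_quot S -> Q, forall x, g (ipi S x) = f x.
  by apply: ideal_quot_lift; [exact: rmorphB|move=> c s Ss]; rewrite /= rmorphM (fS s) // mulr0.
have [||h hE] := @rmorphism_intro _ _ g.
- move=> x y; have [[x' ->] [y' ->]] := (ipiP x, ipiP y).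
  by rewrite -rmorphB !gE rmorphB.
- split=> [|x y]; first by rewrite -(rmorph1 (ipi S)) gE rmorph1.
  have [[x' ->] [y' ->]] := (ipiP x, ipiP y).
  by rewrite -rmorphM !gE rmorphM.
by exists h => x; rewrite hE gE.
Qed.

End IdealQuotientTheory.

(** [(a, b)] stands for a + b eps with eps^2 = 0. The new name keeps the componentwise product of
    pairs from being inferred. *)
Definition dual_numbers (R : comPzRingType) : Type := (R * R)%type.

Section DualNumbers.
Variable R : comPzRingType.
Local Notation D := (dual_numbers R).

HB.instance Definition _ := GRing.Zmodule.on D.

Let mulD (x y : D) : D := (x.1 * y.1, x.1 * y.2 + x.2 * y.1).
Let mulDA : associative mulD.
Proof. by move=> [x x'] [y y'] [z z']; congr pair => /=; ring. Qed.
Let mulDC : commutative mulD.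
Proof. by move=> [x x'] [y y']; congr pair => /=; ring. Qed.
Let mul1D : left_id (1, 0) mulD.
Proof. by move=> [x x']; congr pair => /=; ring. Qed.
Let mulDDl : left_distributive mulD +%R.
Proof. by move=> [x x'] [y y'] [z z']; congr pair => /=; ring. Qed.

HB.instance Definition _ := GRing.Zmodule_isComPzRing.Build D mulDA mulDC mul1D mulDDl.

Lemma dualM (x y : D) : x * y = (x.1 * y.1, x.1 * y.2 + x.2 * y.1) :> D.
Proof. by []. Qed.

Lemma dual_sum (I : Type) (r : seq I) (P : pred I) (F : I -> D) :
  \sum_(i <- r | P i) F i =
  (\sum_(i <- r | P i) (F i).1, \sum_(i <- r | P i) (F i).2) :> D.
Proof.
rewrite [LHS]surjective_pairing.
by congr pair; [apply: (big_morph fst)|apply: (big_morph snd)].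
Qed.

Lemma dual_cst_zmod_morphism : zmod_morphism (fun x => (x, 0) : D).
Proof. by move=> x y; congr pair; rewrite subr0. Qed.
Lemma dual_cst_monoid_morphism : monoid_morphism (fun x => (x, 0) : D).
Proof. by split=> // x y; rewrite dualM /= mulr0 mul0r addr0. Qed.

End DualNumbers.

(** * Derivations, Poisson brackets and Dirac reduction *)

(** Vanishing on the constants [k c] stands in for linearity, so that [R] needs no module
    structure. *)
Record derivation_over (R : comPzRingType) (K : Type) (k : K -> R) (D : R -> R) : Prop :=
  DerivationOver {
  derB : zmod_morphism D;
  derM : forall x y, D (x * y) = D x * y + x * D y;
  der_cst : forall c, D (k c) = 0
}.

Section DerivationTheory.
Variables (R : comPzRingType) (K : Type) (k : K -> R) (D : R -> R).
Hypothesis dD : derivation_over k D.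

Lemma der0 : D 0 = 0.
Proof. by have := derB dD 0 0; rewrite !subr0 subrr. Qed.
Lemma derN x : D (- x) = - D x.
Proof. by have := derB dD 0 x; rewrite der0 !sub0r => ->. Qed.
Lemma derD x y : D (x + y) = D x + D y.
Proof. by rewrite -{1}[y]opprK (derB dD) derN opprK. Qed.
Lemma derZ c x : D (k c * x) = k c * D x.
Proof. by rewrite (derM dD) (der_cst dD) mul0r add0r. Qed.
Lemma der_sum (I : Type) (r : seq I) (P : pred I) (F : I -> R) :
  D (\sum_(i <- r | P i) F i) = \sum_(i <- r | P i) D (F i).
Proof. exact: (big_morph D derD der0). Qed.

(** By the Leibniz rule, [D] sends every multiple of a generator [s] into the ideal [J] as soon as
    [s] and [D s] lie in [J]. *)
Lemma der_ideal_gen (S J : R -> Prop) :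
  (forall x y, J x -> J y -> J (x + y)) -> (forall a x, J x -> J (a * x)) -> J 0 ->
  (forall s, S s -> J s /\ J (D s)) ->
  forall x, ideal_gen S x -> J (D x).
Proof.
move=> JD JM J0 SJ x; elim=> [|c s {}x Ss _ IH]; first by rewrite der0.
rewrite derD (derM dD); have [Js JDs] := SJ _ Ss.
exact: (JD _ _ (JD _ _ (JM _ _ _) (JM _ _ _)) IH).
Qed.

End DerivationTheory.

Lemma derivation0 (R : comPzRingType) (K : Type) (k : K -> R) :
  derivation_over k (fun => 0).
Proof. by split=> [x y|x y|//]; rewrite ?subrr // mul0r mulr0 addr0. Qed.

Lemma derivationB (R : comPzRingType) (K : Type) (k : K -> R) (D E : R -> R) :
  derivation_over k D -> derivation_over k E ->
  derivation_over k (fun x => D x - E x).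
Proof.
move=> dD dE; split=> [x y|x y|c].
- by rewrite (derB dD) (derB dE); ring.
- by rewrite (derM dD) (derM dE); ring.
- by rewrite (der_cst dD) (der_cst dE) subrr.
Qed.

Record poisson_over (R : comPzRingType) (K : Type) (k : K -> R) (pb : R -> R -> R) :
  Prop := PoissonOver {
  pois_der : forall x, derivation_over k (pb x);
  pois_anti : forall x y, pb x y = - pb y x;
  pois_jacobi : forall x y z, pb x (pb y z) + pb y (pb z x) + pb z (pb x y) = 0
}.

Section DiracReduction.
Variables (R : comPzRingType) (S : R -> Prop) (K : Type) (k : K -> R).
Variables (pb : R -> R -> R) (sg : {rmorphism R -> R}) (h : K).
Hypothesis h2 : k h + k h = 1.
Hypothesis pbP : poisson_over k pb.
Hypothesis sgK : involutive sg.
Hypothesis sg_cst : forall c, sg (k c) = k c.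
Hypothesis sg_pb : forall x y, sg (pb x y) = pb (sg x) (sg y).
Hypothesis S_sg : forall s, S s -> exists u, s = u - sg u.
Hypothesis pi_sg : forall u, ipi S (sg u) = ipi S u.
Local Notation pi := (ipi S).

Let avg (x : R) : R := k h * (x + sg x).

Let sg_avg x : sg (avg x) = avg x.
Proof. by rewrite rmorphM rmorphD sg_cst sgK [sg x + x]addrC. Qed.

Let pi_avg x : pi (avg x) = pi x.
Proof.
rewrite /avg ipiM ipiD pi_sg mulrDr -mulrDl -ipiD h2.
by rewrite ipi1 mul1r.
Qed.

Let pb_pi0 x y : sg y = y -> pi x = 0 -> pi (pb y x) = 0.
Proof.
move=> sy /ipi0P Sx; pose J z := pi z = 0.
apply: (der_ideal_gen (pois_der pbP y) (J := J)) Sx; rewrite /J.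
- by move=> a b Ja Jb; rewrite ipiD Ja Jb addr0.
- by move=> a b Jb; rewrite ipiM Jb mulr0.
- exact: ipi0.
move=> s /S_sg [u ->]; rewrite ipiB pi_sg subrr; split=> //.
by rewrite (derB (pois_der pbP y)) ipiB -{2}sy -sg_pb pi_sg subrr.
Qed.

(* Well defined because [pb y] preserves the ideal generated by [S] when [y] is
   [sg]-invariant: [pb y (u - sg u) = pb y u - sg (pb y u)]. *)
Definition dirac_bracket (x y : ideal_quot S) : ideal_quot S :=
  pi (pb (avg (repr x)) (avg (repr y))).

(** The representatives in [dirac_bracket] are replaced one at a time by [pb_pi0], and each
    replacement needs the other argument to be invariant; this is why the definition averages both
    arguments. *)
Let dirac_avg x y : sg x = x -> dirac_bracket (pi x) (pi y) = pi (pb x (avg y)).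
Proof.
move=> sx; rewrite /dirac_bracket; set x' := repr _; set y' := repr _.
have Ex : pi (avg x' - x) = 0 by rewrite ipiB pi_avg ipi_repr subrr.
have Ey : pi (avg y' - avg y) = 0 by rewrite ipiB !pi_avg ipi_repr subrr.
have := pb_pi0 sx Ey; rewrite (derB (pois_der pbP x)) ipiB => /subr0_eq <-.
have := pb_pi0 (sg_avg y') Ex; rewrite (derB (pois_der pbP _)) ipiB.
by move=> /subr0_eq /(congr1 -%R); rewrite -!ipiN -!(pois_anti pbP).
Qed.

(** For invariant [x] the map [pb x] commutes with averaging, and averaging changes nothing modulo
    the ideal. *)
Lemma dirac_bracketE x y : sg x = x -> dirac_bracket (pi x) (pi y) = pi (pb x y).
Proof.
move=> sx; rewrite dirac_avg // (derZ (pois_der pbP x)) (derD (pois_der pbP x)).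
by rewrite -{2}sx -sg_pb pi_avg.
Qed.

Lemma dirac_bracket_pi x y :
  dirac_bracket (pi x) (pi y) = pi (pb (k h * (x + sg x)) y).
Proof. by rewrite -[pi x]pi_avg dirac_bracketE. Qed.

Let liftP (x : ideal_quot S) : exists2 y, sg y = y & x = pi y.
Proof. by have [y ->] := ipiP x; exists (avg y); rewrite ?pi_avg. Qed.

Lemma dirac_poisson : poisson_over (fun c => pi (k c)) dirac_bracket.
Proof.
split=> [x|x y|x y z].
- have [{}x sx ->] := liftP x; split=> [y z|y z|c].
  + have [[{}y ->] [{}z ->]] := (ipiP y, ipiP z).
    by rewrite -ipiB !dirac_bracketE // (derB (pois_der pbP x)) ipiB.
  + have [[{}y ->] [{}z ->]] := (ipiP y, ipiP z).
    by rewrite -ipiM !dirac_bracketE // (derM (pois_der pbP x)) ipiD !ipiM.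
  + by rewrite dirac_bracketE // (der_cst (pois_der pbP x)) ipi0.
- have [[{}x sx ->] [{}y sy ->]] := (liftP x, liftP y).
  by rewrite !dirac_bracketE // (pois_anti pbP) ipiN.
have [[{}x sx ->] [{}y sy ->]] := (liftP x, liftP y); have [{}z sz ->] := liftP z.
by rewrite !dirac_bracketE // -!ipiD (pois_jacobi pbP) ipi0.
Qed.

End DiracReduction.

(** * Separating linear functionals *)

Section LinearFunctional.
Local Notation csetU := classical_sets.setU.
Local Open Scope classical_set_scope.
Variables (K : fieldType) (V : lmodType K).

Definition subspace (W : set V) : Prop :=
  W 0 /\ forall c x y, W x -> W y -> W (c *: x + y).

Lemma subspace_avoiding (e v : V) : e != 0 -> (forall c, v <> c *: e) ->
  exists W : set V, [/\ subspace W, W v, ~ W e & forall x, exists c, W (x - c *: e)].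
Proof.
move=> e0 ve.
(* Zorn yields [W] maximal such that [W + K v] is a subspace avoiding [e]; unlike
   the property of containing [v], this one holds for the union of the empty chain. *)
pose line : set V := fun x => exists c, x = c *: v.
pose P (W : set V) := subspace (csetU W line) /\ ~ csetU W line e.
have lineS : subspace line.
  split; first by exists 0; rewrite scale0r.
  by move=> c _ _ [a ->] [b ->]; exists (c * a + b); rewrite scalerDl scalerA.
have lineNe : ~ line e.
  move=> [c Ec]; have c0 : c != 0 by apply: contraNneq e0 => c0; rewrite Ec c0 scale0r.
  by apply: (ve c^-1); rewrite Ec scalerA mulVf // scale1r.
have [|W [[WS WNe] Wmax]] := @Zorn_bigcup V P.
  move=> F FP Ftot; split; last first.
    by move=> [[X FX Xe]|//]; apply: (FP X FX).2; left.
  split; first by right; case: lineS.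
  have common x y : csetU (\bigcup_(X in F) X) line x -> csetU (\bigcup_(X in F) X) line y ->
      line x /\ line y \/ exists2 X, F X & csetU X line x /\ csetU X line y.
    move=> [[X FX Xx]|lx] [[Y FY Yy]|ly].
    - right; case: (Ftot _ _ FX FY) => [XY|YX].
        by exists Y => //; split; left => //; apply: XY.
      by exists X => //; split; left => //; apply: YX.
    - by right; exists X => //; split; [left|right].
    - by right; exists Y => //; split; [right|left].
    - by left.
  move=> c x y Ux Uy; have [[lx ly]|[X FX [Xx Xy]]] := common _ _ Ux Uy.
    by right; apply: lineS.2.
  by case: ((FP X FX).1.2 c _ _ Xx Xy) => ?; [left; exists X|right].
pose W' := csetU W line.
exists W'; split=> //; first by right; exists 1; rewrite scale1r.
move=> x; have [W'x|W'Nx] := pselect (W' x).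
  by exists 0; rewrite scale0r subr0.
(* [U] is [W' + K x]. By maximality it cannot avoid [e], and solving the resulting relation for [x]
   gives the coordinate of [x] along [e]. *)
pose U : set V := fun y => exists2 c, W' (y - c *: x) & True.
have W'U : W' `<=` U by move=> y W'y; exists 0; rewrite // scale0r subr0.
have Ux : U x by exists 1; rewrite // scale1r subrr; case: WS.
have US : subspace U.
  split; first by apply: W'U; case: WS.
  move=> c y z [a Wy _] [b Wz _]; exists (c * a + b) => //.
  have -> : c *: y + z - (c * a + b) *: x = c *: (y - a *: x) + (z - b *: x).
    by rewrite scalerDl -scalerA scalerBr opprD addrACA.
  exact: WS.2.
have UE : csetU U line = U.
  apply/seteqP; split=> [y [//|ly]|y Uy]; last by left.
  by apply: W'U; right.
have [[c Wc _]|UNe] := pselect (U e).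
  have c0 : c != 0 by apply/eqP => c0; apply: WNe; rewrite c0 scale0r subr0 in Wc.
  exists c^-1; have := WS.2 (- c^-1) _ _ Wc WS.1.
  by rewrite addr0 scalerBr !scaleNr scalerA mulVf // scale1r opprK addrC.
have PU : P U by rewrite /P UE.
have WU : W `<` U.
  split=> [y Wy|UW]; first by apply: W'U; left.
  by apply: W'Nx; left; apply: UW.
by case: (Wmax _ WU).
Qed.

(** [W] is a complement of the line through [e] that contains [v]; the functional is the coordinate
    along [e], well defined because [W] avoids [e]. *)
Lemma functional_separating (e v : V) : e != 0 -> (forall c, v <> c *: e) ->
  exists f : V -> K^o, [/\ linear f, f e = 1 & f v = 0].
Proof.
move=> e0 ve; have [W [[W0 WS] Wv WNe Wall]] := subspace_avoiding e0 ve.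
have [f fP] := choice Wall.
have uniq x c : W (x - c *: e) -> f x = c.
  move=> Wc; apply/eqP; apply/negPn/negP => /negP fc; apply: WNe.
  have d0 : c - f x != 0 by rewrite subr_eq0 eq_sym; apply/negP.
  have := WS (-1) _ _ Wc (fP x); rewrite scaleN1r opprB addrA subrK.
  rewrite -scalerBl => Wd.
  by have := WS (c - f x)^-1 _ _ Wd W0; rewrite addr0 scalerA mulVf // scale1r.
exists f; split=> [c x y||].
- apply: uniq; rewrite scalerDl -scalerA opprD addrACA -scalerBr.
  by apply: WS; apply: fP.
- by apply: uniq; rewrite scale1r subrr.
- by apply: uniq; rewrite scale0r subr0.
Qed.

End LinearFunctional.

(** If [v] were not a multiple of [e], a functional [f] with [f e = 1] and [f v = 0], applied to the
    left factor, would turn the equation into [0 = v]. *)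
Lemma tens_comm (K : fieldType) (V : lmodType K) (e v : V) :
  tens v e = tens e v -> e != 0 -> exists c, v = c *: e.
Proof.
move=> Evw e0; apply/not_existsP => ve; have [f [fl fe fv]] := functional_separating e0 ve.
have fbil : bilinear (fun x y : V => (f x : K) *: y).
  split=> [y a x x'|x a y y'] /=; first by rewrite fl scalerDl scalerA.
  by rewrite scalerDr !scalerA mulrC.
have := congr1 (tlift (fun x y : V => (f x : K) *: y)) Evw.
rewrite !tlift_tens // fe fv scale0r scale1r => v0.
by apply: (ve 0); rewrite scale0r.
Qed.

(** * Index combinatorics, orthogonal and symplectic groups *)

(** Evenness of [m] keeps the shifted index below [m], so the default value of [insubd] is not
    reached. *)
Lemma theta_blockE t m (j : 'I_m) : (is_Sp t -> ~~ odd m) ->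
  theta_block t j = (if is_Sp t then if j < m./2 then j + m./2 else j - m./2 else j)%N :> nat.
Proof.
case: t => //= /(_ isT) m_even; rewrite insubdK // unfold_in /=.
have := odd_double_half m; rewrite (negbTE m_even) add0n; have := ltn_ord j.
by case: ifP; lia.
Qed.

Lemma theta_blockK t m : (is_Sp t -> ~~ odd m) -> involutive (@theta_block t m).
Proof.
move=> m_even j; apply: val_inj; rewrite /= !theta_blockE //.
case: t m_even => //= /(_ isT) m_even.
have := odd_double_half m; rewrite (negbTE m_even) add0n; have := ltn_ord j.
by case: (ltnP j m./2); case: ifP; lia.
Qed.

Lemma Theta_blockE (Q : comPzRingType) t m (i j : 'I_m) : (is_Sp t -> ~~ odd m) ->
  Theta_block Q t m i j =
  (-1) ^+ (is_Sp t && (m./2 <= i)%N) * (j == theta_block t i)%:R.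
Proof.
move=> m_even; rewrite -val_eqE /= theta_blockE //.
case: t m_even => /= [_|/(_ isT) m_even]; first by rewrite mxE expr0 mul1r eq_sym.
rewrite mxE; have := odd_double_half m; rewrite (negbTE m_even) add0n.
move: (ltn_ord i) (ltn_ord j); case: (ltnP i m./2) => le_mi lt_im lt_jm Em.
  have -> : (i == j + m./2 :> nat)%N = false by apply/negbTE/eqP; lia.
  by rewrite expr0 mul1r subr0.
have -> : (j == i + m./2 :> nat)%N = false by apply/negbTE/eqP; lia.
have -> : (i == j + m./2 :> nat)%N = (j == i - m./2 :> nat)%N by apply/eqP/eqP; lia.
by rewrite expr1 sub0r mulN1r.
Qed.

Section BlockDiagonal.
Variables (n : nat) (alpha : 'I_n -> nat) (Q : comPzRingType).
Let N := (\sum_s alpha s)%N.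

Lemma blk_Rank s (i : 'I_(alpha s)) : blk (tagnat.Rank s i) = s.
Proof. exact: tagnat.Rank1K. Qed.

Lemma RankP (k : 'I_N) : exists s (i : 'I_(alpha s)), k = tagnat.Rank s i.
Proof. by exists (blk k), (tagnat.sig2 k); rewrite tagnat.sig2K. Qed.

(** An entrywise condition, so that products and images under ring morphisms can be handled without
    families of blocks of varying size. *)
Definition block_diag (M : 'M[Q]_N) := forall i j, blk i != blk j -> M i j = 0.

Lemma mxdiagE (M_ : forall s, 'M[Q]_(alpha s)) s (i j : 'I_(alpha s)) :
  (\mxdiag_s M_ s) (tagnat.Rank s i) (tagnat.Rank s j) = M_ s i j.
Proof. by have := submxblock_diag M_ s => /matrixP/(_ i j); rewrite mxE. Qed.

Lemma mxdiag_block_diag (M_ : forall s, 'M[Q]_(alpha s)) : block_diag (\mxdiag_s M_ s).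
Proof. by move=> i j ij; rewrite mxE ifN // mxE. Qed.

Lemma block_diagE (M : 'M[Q]_N) : block_diag M -> M = \mxdiag_s submxblock M s s.
Proof.
move=> MD; apply/matrixP => i j; have [eq_ij|ne_ij] := eqVneq (blk i) (blk j); last first.
  by rewrite MD // mxdiag_block_diag.
have [[s [i' Ei]] [t [j' Ej]]] := (RankP i, RankP j).
have st : s = t by move: eq_ij; rewrite Ei Ej !blk_Rank.
by move: st j' Ej => <- j' ->; rewrite Ei mxdiagE mxE.
Qed.

Lemma mulmx_mxdiag (A B : forall s, 'M[Q]_(alpha s)) :
  \mxdiag_s A s *m \mxdiag_s B s = \mxdiag_s (A s *m B s).
Proof.
rewrite {2}/mxdiag mul_mxdiag_mxblock; apply: eq_mxblock => i j.
by case: eqP => [->|_]; rewrite ?mulmx0 // !conform_mx_id.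
Qed.

Lemma block_diag_mul M M' : block_diag M -> block_diag M' -> block_diag (M *m M').
Proof.
move=> /block_diagE -> /block_diagE ->; rewrite mulmx_mxdiag.
exact: mxdiag_block_diag.
Qed.

End BlockDiagonal.

Section Theta.
Variables (n : nat) (ty : 'I_n -> block_type) (alpha : 'I_n -> nat).
Hypothesis halpha : typed_dimension ty alpha.
Let N := (\sum_s alpha s)%N.

Lemma theta_Rank s (j : 'I_(alpha s)) :
  theta ty (tagnat.Rank s j) = tagnat.Rank s (theta_block (ty s) j).
Proof.
rewrite /theta /blk /tagnat.sig1 /tagnat.sig2 /tagnat.Rank tagnat.rankK //.
Qed.

Lemma blk_theta (k : 'I_N) : blk (theta ty k) = blk k.
Proof. by rewrite blk_Rank. Qed.

Lemma thetaK : involutive (@theta n ty alpha).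
Proof.
move=> k; have [s [j ->]] := RankP k.
by rewrite !theta_Rank theta_blockK //; apply: halpha.
Qed.

(** The exponent of the sign in [sgn1], which is also the sign of the nonzero entry of [Theta] in
    row [k]. *)
Definition lower (k : 'I_N) : bool :=
  is_Sp (ty (blk k)) && ((alpha (blk k))./2 <= tagnat.sig2 k)%N.

Lemma lower_Rank s (j : 'I_(alpha s)) :
  lower (tagnat.Rank s j) = is_Sp (ty s) && ((alpha s)./2 <= j)%N.
Proof. by rewrite /lower /blk /tagnat.sig1 /tagnat.sig2 /tagnat.Rank tagnat.rankK. Qed.

Lemma lower_theta (k : 'I_N) : lower (theta ty k) = is_Sp (ty (blk k)) (+) lower k.
Proof.
have [s [j ->]] := RankP k; rewrite theta_Rank !lower_Rank blk_Rank.
rewrite theta_blockE; last exact: halpha.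
have := @halpha s; case: (ty s) => //= /(_ isT) m_even.
have := odd_double_half (alpha s); rewrite (negbTE m_even) add0n; have := ltn_ord j.
case: (ltnP j (alpha s)./2) => jh lt_j E /=; first by apply/idP; lia.
by apply/negbTE; rewrite -ltnNge; lia.
Qed.

Lemma sgn1E (K : fieldType) (k : 'I_N) : sgn1 K ty k = (-1) ^+ lower k.
Proof. by []. Qed.

(** [theta] exchanges the halves of a symplectic block, and the resulting sign flips cancel the type
    signs in [sgn2]. What remains is the sign occurring in [Theta M^T Theta^T], see [theta_adjE]. *)
Lemma sgn2_theta (K : fieldType) (i j : 'I_N) :
  sgn2 K ty (theta ty i) (theta ty j) = (-1) ^+ lower i * (-1) ^+ lower j.
Proof.
rewrite /sgn2 !blk_theta /type_sign !sgn1E !lower_theta !signr_addb.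
by rewrite !signrMK.
Qed.

(** Compares the sign of [Theta^T M^T Theta] with that of [Theta M^T Theta^T]; the discrepancy is
    the factor occurring in [w^2]. *)
Lemma sgn2_thetaK (K : fieldType) (i j : 'I_N) :
  sgn2 K ty i j * sgn2 K ty (theta ty i) (theta ty j) =
  type_sign K (ty (blk i)) * type_sign K (ty (blk j)).
Proof.
rewrite sgn2_theta /sgn2 !sgn1E.
rewrite [_ * _ * (_ * _)]mulrACA -!mulrA [X in _ * X]mulrC.
by case: (lower i); case: (lower j); rewrite ?expr1 ?expr0; ring.
Qed.

Lemma sgn2C (K : fieldType) (i j : 'I_N) : sgn2 K ty i j = sgn2 K ty j i.
Proof. by rewrite /sgn2 mulrC. Qed.

Lemma sgn2_theta_sqr (K : fieldType) (i j : 'I_N) :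
  sgn2 K ty (theta ty i) (theta ty j) * sgn2 K ty (theta ty i) (theta ty j) = 1.
Proof. by rewrite sgn2_theta -expr2 exprMn !sqrr_sign mulr1. Qed.

Section ThetaMatrix.
Variable Q : comPzRingType.

(** Being a signed permutation matrix, it collapses every matrix product with [Theta] to a single
    term; [Theta_mx_diag] links it to the block definition. *)
Definition Theta_mx : 'M[Q]_N :=
  \matrix_(i, j) ((-1) ^+ lower i * (j == theta ty i)%:R).

Lemma Theta_mx_diag : Theta_mx = \mxdiag_s Theta_block Q (ty s) (alpha s).
Proof.
apply/matrixP => i j; rewrite mxE; apply: esym.
have [eq_ij|ne_ij] := eqVneq (blk i) (blk j); last first.
  rewrite mxdiag_block_diag //; case: eqP => [Ej|]; last by rewrite mulr0.
  by rewrite Ej blk_theta eqxx in ne_ij.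
have [[s [i' Ei]] [t [j' Ej]]] := (RankP i, RankP j).
have st : s = t by move: eq_ij; rewrite Ei Ej !blk_Rank.
move: st j' Ej => <- j' ->; rewrite Ei mxdiagE Theta_blockE; last exact: halpha.
rewrite lower_Rank theta_Rank; congr (_ * _%:R); congr nat_of_bool.
by rewrite -[in RHS]val_eqE tagnat.eq_Rank eqxx.
Qed.

Lemma Theta_mulK : Theta_mx *m Theta_mx^T = 1%:M.
Proof.
apply/matrixP => i j; rewrite !mxE (bigD1 (theta ty i)) //= big1 => [|r r_i].
  rewrite !mxE eqxx mulr1 addr0 (inj_eq (inv_inj thetaK)).
  by case: eqP => [->|]; rewrite ?mulr0 // mulr1 -expr2 sqrr_sign.
by rewrite !mxE (negbTE r_i) mulr0 mul0r.
Qed.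

Lemma Theta_mulVK : Theta_mx^T *m Theta_mx = 1%:M.
Proof.
apply/matrixP => i j; rewrite !mxE (bigD1 (theta ty i)) //= big1 => [|r r_i].
  rewrite !mxE !thetaK eqxx mulr1 addr0 mulrA -expr2 sqrr_sign mul1r.
  by rewrite eq_sym.
have /negbTE ri : i != theta ty r by apply: contra r_i => /eqP ->; rewrite thetaK.
by rewrite !mxE ri mulr0 mul0r.
Qed.

(** On block-diagonal matrices this is the adjoint for the form [Theta]: it inverts the elements of
    G and negates those of the Lie algebra. *)
Definition theta_adj (M : 'M[Q]_N) : 'M[Q]_N := Theta_mx *m M^T *m Theta_mx^T.

Lemma theta_adjE M i j :
  theta_adj M i j = (-1) ^+ lower i * (-1) ^+ lower j * M (theta ty j) (theta ty i).
Proof.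
rewrite !mxE (bigD1 (theta ty j)) //= big1 => [|r r_j]; last first.
  by rewrite !mxE (negbTE r_j) !mulr0.
rewrite !mxE (bigD1 (theta ty i)) //= big1 => [|r r_i]; last first.
  by rewrite !mxE (negbTE r_i) mulr0 mul0r.
by rewrite !mxE !eqxx !mulr1 !addr0 mulrAC.
Qed.

Lemma theta_adjM M M' : theta_adj (M *m M') = theta_adj M' *m theta_adj M.
Proof.
rewrite /theta_adj trmx_mul !mulmxA -[_ *m _^T *m Theta_mx]mulmxA Theta_mulVK.
by rewrite mulmx1.
Qed.

Lemma theta_adjD M M' : theta_adj (M + M') = theta_adj M + theta_adj M'.
Proof. by rewrite /theta_adj linearD /= mulmxDr mulmxDl. Qed.

Lemma theta_adjN M : theta_adj (- M) = - theta_adj M.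
Proof. by rewrite /theta_adj linearN /= mulmxN mulNmx. Qed.

Lemma in_GP (g : 'M[Q]_N) :
  in_G ty g <-> block_diag g /\ g^T *m Theta_mx *m g = Theta_mx.
Proof.
split=> [[g_ [gG ->]]|[gD gG]].
  split; first exact: mxdiag_block_diag.
  by rewrite Theta_mx_diag tr_mxdiag !mulmx_mxdiag; apply: eq_mxdiag.
exists (fun s => submxblock g s s); split; last exact: block_diagE.
move: gG; rewrite {1 2}[g]block_diagE // Theta_mx_diag tr_mxdiag !mulmx_mxdiag.
by move=> /eq_mxdiagP gG s; apply: gG.
Qed.

Lemma in_LieP (x : 'M[Q]_N) :
  in_Lie ty x <-> block_diag x /\ x^T *m Theta_mx + Theta_mx *m x = 0.
Proof.
split=> [[x_ [xL ->]]|[xD xL]].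
  split; first exact: mxdiag_block_diag.
  rewrite Theta_mx_diag tr_mxdiag !mulmx_mxdiag -mxdiagD -[RHS]mxdiag0.
  exact: eq_mxdiag.
exists (fun s => submxblock x s s); split; last exact: block_diagE.
move: xL; rewrite {1 2}[x]block_diagE // Theta_mx_diag tr_mxdiag !mulmx_mxdiag -mxdiagD -[RHS]mxdiag0.
by move=> /eq_mxdiagP xL s; apply: xL.
Qed.

(** Transposing the equation that defines G puts [Theta^T] in place of [Theta], as the convention of
    [theta_adj] requires. *)
Lemma theta_adj_in_G g : in_G ty g -> theta_adj g *m g = 1%:M.
Proof.
move=> /in_GP [_ /(congr1 trmx)]; rewrite !trmx_mul trmxK => gG.
by rewrite /theta_adj -!mulmxA (mulmxA g^T) in gG *; rewrite gG Theta_mulK.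
Qed.

Lemma theta_adj_in_Lie x : in_Lie ty x <-> block_diag x /\ theta_adj x = - x.
Proof.
rewrite in_LieP; split=> -[xD xL]; split=> //.
  move: xL => /(congr1 trmx); rewrite linearD /= !trmx_mul trmxK trmx0.
  move=> /(congr1 (mulmx Theta_mx)); rewrite mulmxDr mulmx0 !mulmxA Theta_mulK mul1mx.
  by move=> /addr0_eq ->.
apply: trmx_inj; rewrite linearD /= !trmx_mul trmxK trmx0.
have := congr1 (mulmx Theta_mx^T) xL.
rewrite /theta_adj !mulmxA Theta_mulVK mul1mx mulmxN => ->.
by rewrite addrN.
Qed.

End ThetaMatrix.

Lemma map_theta_adj (Q Q' : comPzRingType) (f : {rmorphism Q -> Q'}) (M : 'M[Q]_N) :
  map_mx f (theta_adj M) = theta_adj (map_mx f M).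
Proof.
apply/matrixP => i j; rewrite mxE !theta_adjE !rmorphM !rmorph_sign mxE //.
Qed.

Section Field.
Variable K : fieldType.

Lemma in_G_unit (g : 'M[K]_N) : in_G ty g -> g \in unitmx.
Proof. by move=> /theta_adj_in_G gg; case: (mulmx1_unit gg). Qed.

Lemma in_G_inv (g : 'M[K]_N) : in_G ty g -> invmx g = theta_adj g.
Proof.
move=> gG; have gU := in_G_unit gG.
by rewrite -[RHS]mulmx1 -(mulmxV gU) mulmxA theta_adj_in_G // mul1mx.
Qed.

Lemma in_GV (g : 'M[K]_N) : in_G ty g -> in_G ty (invmx g).
Proof.
move=> gG; have gU := in_G_unit gG; have [gD gT] := (in_GP g).1 gG.
apply/in_GP; split.
  rewrite in_G_inv // => i j ij; rewrite theta_adjE gD ?mulr0 // !blk_theta.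
  by rewrite eq_sym.
rewrite -{1}gT -!mulmxA mulmxV // mulmx1 mulmxA -trmx_mul mulmxV // trmx1 mul1mx //.
Qed.

Lemma in_G1 : in_G ty (1%:M : 'M[K]_N).
Proof.
apply/in_GP; rewrite trmx1 mul1mx mulmx1; split=> // i j ij.
by rewrite mxE; case: (i =P j) ij => // ->; rewrite eqxx.
Qed.

Lemma in_GM (g h : 'M[K]_N) : in_G ty g -> in_G ty h -> in_G ty (g *m h).
Proof.
move=> /in_GP [gD gT] /in_GP [hD hT]; apply/in_GP; split.
  exact: block_diag_mul.
by rewrite trmx_mul !mulmxA -(mulmxA h^T) -(mulmxA h^T) gT hT.
Qed.

Lemma theta_adjV (g : 'M[K]_N) : in_G ty g -> theta_adj (invmx g) = g.
Proof. by move=> gG; rewrite -in_G_inv ?invmxK //; apply: in_GV. Qed.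

End Field.
End Theta.

(** * Tensor products *)

Section LinearClosure.
Variables (K : fieldType) (U V W : lmodType K).

Lemma linear_comp (f : V -> W) (g : U -> V) :
  linear f -> linear g -> linear (fun x => f (g x)).
Proof. by move=> fL gL c x y; rewrite gL fL. Qed.

Lemma linear_add (f g : U -> V) :
  linear f -> linear g -> linear (fun x => f x + g x).
Proof. by move=> fL gL c x y; rewrite fL gL scalerDr addrACA. Qed.

Lemma linear_id : linear (fun x : U => x).
Proof. by []. Qed.

Lemma lin0 (f : U -> V) : linear f -> f 0 = 0.
Proof. by move=> fL; have := fL (-1) 0 0; rewrite scaler0 add0r scaleN1r addNr. Qed.
Lemma linD (f : U -> V) x y : linear f -> f (x + y) = f x + f y.
Proof. by move=> fL; have := fL 1 x y; rewrite !scale1r. Qed.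
Lemma linN (f : U -> V) x : linear f -> f (- x) = - f x.
Proof. by move=> fL; have := fL (-1) x 0; rewrite !scaleN1r !addr0 lin0 // addr0. Qed.
Lemma linB (f : U -> V) x y : linear f -> f (x - y) = f x - f y.
Proof. by move=> fL; rewrite linD // linN. Qed.
Lemma linZ (f : U -> V) c x : linear f -> f (c *: x) = c *: f x.
Proof. by move=> fL; have := fL c x 0; rewrite !addr0 lin0 // addr0. Qed.
Lemma lin_sum (f : U -> V) (I : Type) (r : seq I) (P : pred I) (F : I -> U) :
  linear f -> f (\sum_(i <- r | P i) F i) = \sum_(i <- r | P i) f (F i).
Proof. by move=> fL; apply: big_morph; [move=> x y; apply: linD|apply: lin0]. Qed.

End LinearClosure.

Section TensorTheory.
Variable K : fieldType.

Lemma tensor_ext (U V W : lmodType K) (f g : tensor U V -> W) :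
  linear f -> linear g -> (forall u v, f (tens u v) = g (tens u v)) -> f =1 g.
Proof.
move=> fL gL fg d; pattern d; apply: tensor_span; first by rewrite !lin0.
by move=> c u v x IH; rewrite fL gL fg IH.
Qed.

Lemma tmap_bilinear (U V U' V' : lmodType K) (f : U -> U') (g : V -> V') :
  linear f -> linear g -> bilinear (fun u v => tens (f u) (g v)).
Proof.
have [tl tr] := @tens_bilinear K U' V'.
by move=> fL gL; split=> [v|u] c x y; rewrite ?fL ?gL ?tl ?tr.
Qed.

Lemma tmap_linear (U V U' V' : lmodType K) (f : U -> U') (g : V -> V') :
  linear f -> linear g -> linear (tmap f g).
Proof. by move=> fL gL; apply/tlift_linear/tmap_bilinear. Qed.

Lemma tmap_tens (U V U' V' : lmodType K) (f : U -> U') (g : V -> V') u v :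
  linear f -> linear g -> tmap f g (tens u v) = tens (f u) (g v).
Proof. by move=> fL gL; rewrite /tmap tlift_tens //; apply: tmap_bilinear. Qed.

Lemma tswap_bilinear (U V : lmodType K) : bilinear (fun (u : U) (v : V) => tens v u).
Proof. by have [tl tr] := @tens_bilinear K V U; split=> [v|u]. Qed.

Lemma tswap_linear (U V : lmodType K) : linear (@tswap K U V).
Proof. exact/tlift_linear/tswap_bilinear. Qed.

Lemma tswap_tens (U V : lmodType K) (u : U) (v : V) : tswap (tens u v) = tens v u.
Proof. by rewrite /tswap tlift_tens //; apply: tswap_bilinear. Qed.

Lemma tswapK (U V : lmodType K) (d : tensor U V) : tswap (tswap d) = d.
Proof.
move: d; apply: tensor_ext; [|exact: linear_id|by move=> u v; rewrite !tswap_tens].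
by apply: linear_comp; apply: tswap_linear.
Qed.

Variable U : lmodType K.

Let tau_inner (a3 : U) : bilinear (fun a1 a2 : U => tens (tens a3 a1) a2).
Proof.
have [tl tr] := @tens_bilinear K (tensor U U) U; have [_ tr'] := @tens_bilinear K U U.
by split=> [v|u] c x y; rewrite ?tr' ?tl ?tr.
Qed.

Let tau_bilinear : bilinear (fun (a12 : tensor U U) (a3 : U) =>
  tlift (fun a1 a2 => tens (tens a3 a1) a2) a12).
Proof.
have [tl _] := @tens_bilinear K (tensor U U) U; have [tl' _] := @tens_bilinear K U U.
have liftL z := tlift_linear (tau_inner z).
split=> [a3|a12 c y z]; first exact: liftL.
pose f (z : U) := tlift (fun a1 a2 : U => tens (tens z a1) a2).
suff: f (c *: y + z) =1 (fun d => c *: f y d + f z d) by apply.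
apply: tensor_ext => [||a1 a2]; first exact: liftL.
  apply: linear_add; last exact: liftL.
  by apply: (@linear_comp _ _ _ _ ( *:%R c)); [move=> b d d'; rewrite linearP|apply: liftL].
have fE u : f u (tens a1 a2) = tens (tens u a1) a2 := tlift_tens (tau_inner u) a1 a2.
by rewrite 3!fE tl' tl.
Qed.

Lemma tau123_linear : linear (@tau123 K U).
Proof. exact: (tlift_linear tau_bilinear). Qed.

Lemma tau123_tens a b c : tau123 (tens (tens a b) c) = tens (tens c a) b :> tensor (tensor U U) U.
Proof. by rewrite /tau123 (tlift_tens tau_bilinear) (tlift_tens (tau_inner _)). Qed.

End TensorTheory.


(** * The representation ring and Van den Bergh's bracket *)

(* Characterises [rep_ring]; nothing below depends on its construction as an
   iterated quotient. *)
Record rep_algebra (K : fieldType) (A : algType K) (n : nat) (e : 'I_n -> A)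
    (alpha : 'I_n -> nat) (R : comPzRingType) (k : K -> R)
    (x : A -> 'I_(\sum_s alpha s)%N -> 'I_(\sum_s alpha s)%N -> R) : Prop := RepAlgebra {
  rep_lin : forall c a b i j, x (c *: a + b) i j = k c * x a i j + x b i j;
  rep_mul : forall a b i j, x (a * b) i j = \sum_r x a i r * x b r j;
  rep_idem : forall s i j, x (e s) i j = ((blk i == s) && (i == j))%:R;
  rep_ind : forall P : R -> Prop,
    (forall c, P (k c)) -> (forall a i j, P (x a i j)) ->
    (forall y z, P y -> P z -> P (y + z)) -> (forall y z, P y -> P z -> P (y * z)) ->
    forall y, P y;
  rep_lift : forall (Q : comPzRingType) (l : {rmorphism K -> Q})
      (Y : A -> 'M[Q]_(\sum_s alpha s)%N),
    (forall c a b, Y (c *: a + b) = l c *: Y a + Y b) ->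
    (forall a b, Y (a * b) = Y a *m Y b) ->
    (forall s, Y (e s) = \matrix_(i, j) ((blk i == s) && (i == j))%:R) ->
    exists f : {rmorphism R -> Q},
      (forall c, f (k c) = l c) /\ (forall a i j, f (x a i j) = Y a i j)
}.

Section RepRing.
Variables (K : fieldType) (A : algType K) (n : nat) (e : 'I_n -> A).
Variable alpha : 'I_n -> nat.
Let N := (\sum_s alpha s)%N.
Local Notation R := (rep_ring e alpha).
Local Notation cst := (rep_cst e alpha).
Local Notation x := (@rep_coord K A n e alpha).

Lemma rep_cst_rmorphism : exists k : {rmorphism K -> R}, k =1 cst.
Proof.
apply: rmorphism_intro => [c d|]; first by rewrite /rep_cst scalerBl ipiB.
split=> [|c d]; first by rewrite /rep_cst scale1r ipi1.
by rewrite /rep_cst -ipiM -scalerAl mul1r scalerA.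
Qed.

Lemma rep_coord_linear c a b i j : x (c *: a + b) i j = cst c * x a i j + x b i j.
Proof.
rewrite /rep_coord /rep_cst -ipiM -ipiD -scalerAl mul1r.
by apply/ipi_eq/ideal_gen_gen; apply: RepRelLin.
Qed.

Lemma rep_coordM a b i j : x (a * b) i j = \sum_r x a i r * x b r j.
Proof.
transitivity (ipi (@rep_rel K A n e alpha) (\sum_r rep_var a i r * rep_var b r j)).
  by apply/ipi_eq/ideal_gen_gen; apply: RepRelMul.
by rewrite rmorph_sum; apply: eq_bigr => r _; rewrite /= ipiM.
Qed.

Lemma rep_coord_idem s i j : x (e s) i j = ((blk i == s) && (i == j))%:R.
Proof.
transitivity (ipi (@rep_rel K A n e alpha) ((blk i == s) && (i == j))%:R).
  by apply/ipi_eq/ideal_gen_gen; apply: RepRelIdem.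
exact: rmorph_nat.
Qed.

Lemma rep_ring_ind (P : R -> Prop) :
  (forall c, P (cst c)) -> (forall a i j, P (x a i j)) ->
  (forall y z, P y -> P z -> P (y + z)) -> (forall y z, P y -> P z -> P (y * z)) ->
  forall y, P y.
Proof.
move=> Pc Px PD PM y; have [f ->] := ipiP y.
elim/malg_poly_ind: f => [c|[[a i] j]|f g Pf Pg|f g Pf Pg].
- exact: Pc.
- exact: Px.
- by rewrite ipiD; apply: PD.
- by rewrite ipiM; apply: PM.
Qed.

Lemma rep_ring_lift (Q : comPzRingType) (k : {rmorphism K -> Q}) (Y : A -> 'M[Q]_N) :
  (forall c a b, Y (c *: a + b) = k c *: Y a + Y b) ->
  (forall a b, Y (a * b) = Y a *m Y b) ->
  (forall s, Y (e s) = \matrix_(i, j) ((blk i == s) && (i == j))%:R) ->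
  exists f : {rmorphism R -> Q},
    (forall c, f (cst c) = k c) /\ (forall a i j, f (x a i j) = Y a i j).
Proof.
move=> YL YM Ye.
have [f0 [f0c f0v]] := malg_poly_lift k (fun v : A * 'I_N * 'I_N => Y v.1.1 v.1.2 v.2).
have [|f fE] := @ideal_quot_rlift _ (@rep_rel K A n e alpha) _ f0; last first.
  by exists f; split=> [c|a i j]; rewrite fE ?f0c // f0v.
have f0x a i j : f0 (rep_var a i j) = Y a i j by rewrite f0v.
have f0Z c v : f0 (c *: v) = k c * f0 v by rewrite -f0c -rmorphM -scalerAl mul1r.
have f0B u v : f0 u = f0 v -> f0 (u - v) = 0 by rewrite rmorphB => ->; apply: subrr.
move=> _ [c a b i j|a b i j|s i j]; apply: f0B; apply: (etrans (f0x _ _ _)).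
- apply: esym; apply: (etrans (rmorphD f0 _ _)); rewrite YL !mxE.
  exact: (congr2 _ (etrans (f0Z _ _) (congr1 _ (f0x _ _ _))) (f0x _ _ _)).
- apply: esym; apply: (etrans (rmorph_sum f0 _ _ _)); rewrite YM mxE.
  apply: eq_bigr => r _; apply: (etrans (rmorphM f0 _ _)).
  exact: (congr2 _ (f0x _ _ _) (f0x _ _ _)).
- by rewrite Ye mxE; apply: esym; apply: rmorph_nat.
Qed.

Lemma rep_ringP : rep_algebra e cst x.
Proof.
split; [exact: rep_coord_linear|exact: rep_coordM|exact: rep_coord_idem
       |exact: rep_ring_ind|exact: rep_ring_lift].
Qed.

End RepRing.

(* [R] as a [K]-module through [k], so that [tlift] can take values in [R]. *)
Definition scalars_via (K : fieldType) (R : comPzRingType) (k : {rmorphism K -> R}) : Type := R.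

Section ScalarsVia.
Variables (K : fieldType) (R : comPzRingType) (k : {rmorphism K -> R}).
HB.instance Definition _ := GRing.Zmodule.on (scalars_via k).
Let scale (c : K) (y : scalars_via k) : scalars_via k := (k c * y : R).
Fact scalars_viaA a b y : scale a (scale b y) = scale (a * b) y.
Proof. by rewrite /scale rmorphM mulrA. Qed.
Fact scalars_via1 : left_id 1 scale.
Proof. by move=> y; rewrite /scale rmorph1 mul1r. Qed.
Fact scalars_viaDr : right_distributive scale +%R.
Proof. by move=> a u v; apply: mulrDr. Qed.
Fact scalars_viaDl y : {morph scale^~ y : a b / a + b}.
Proof. by move=> a b; rewrite /scale rmorphD; apply: mulrDl. Qed.
HB.instance Definition _ := GRing.Zmodule_isLmodule.Build K (scalars_via k)
  scalars_viaA scalars_via1 scalars_viaDr scalars_viaDl.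
End ScalarsVia.

Section ScalarLinear.
Variables (K : fieldType) (R : comPzRingType) (k : {rmorphism K -> R}).

(** The scalars enter a bare ring [R] through [k]; up to conversion this is linearity into
    [scalars_via k]. *)
Definition klinear (V : lmodType K) (f : V -> R) : Prop :=
  forall c u v, f (c *: u + v) = k c * f u + f v.

Section Closure.
Variables (V : lmodType K).
Implicit Types f g : V -> R.

Lemma klinear_sum (I : finType) (F : I -> V -> R) :
  (forall i, klinear (F i)) -> klinear (fun u => \sum_i F i u).
Proof.
move=> FL c u v; rewrite mulr_sumr -big_split /=.
by apply: eq_bigr => i _; rewrite FL.
Qed.
Lemma klinear_mull f y : klinear f -> klinear (fun u => y * f u).
Proof. by move=> fL c u v; rewrite fL; ring. Qed.
Lemma klinear_mulr f y : klinear f -> klinear (fun u => f u * y).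
Proof. by move=> fL c u v; rewrite fL; ring. Qed.
Lemma klinear_add f g : klinear f -> klinear g -> klinear (fun u => f u + g u).
Proof. by move=> fL gL c u v; rewrite fL gL; ring. Qed.
Lemma klinear_comp (U : lmodType K) (f : V -> R) (g : U -> V) :
  klinear f -> linear g -> klinear (fun u => f (g u)).
Proof. by move=> fL gL c u v; rewrite gL fL. Qed.
Lemma klinear_der f (D : R -> R) :
  derivation_over k D -> klinear f -> klinear (fun u => D (f u)).
Proof. by move=> dD fL c u v; rewrite fL (derD dD) (derZ dD). Qed.
Lemma klinear_rmorph f (g : {rmorphism R -> R}) : (forall c, g (k c) = k c) ->
  klinear f -> klinear (fun u => g (f u)).
Proof. by move=> gk fL c u v; rewrite fL rmorphD rmorphM gk. Qed.
Lemma klin0 f : klinear f -> f 0 = 0.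
Proof.
by move=> fL; have := fL (-1) 0 0; rewrite scaler0 add0r rmorphN1 mulN1r addNr.
Qed.
Lemma klinD f u v : klinear f -> f (u + v) = f u + f v.
Proof. by move=> fL; have := fL 1 u v; rewrite scale1r rmorph1 mul1r. Qed.
Lemma klinN f u : klinear f -> f (- u) = - f u.
Proof.
by move=> fL; have := fL (-1) u 0; rewrite scaleN1r !addr0 klin0 // rmorphN1 mulN1r addr0.
Qed.
Lemma klinB f u v : klinear f -> f (u - v) = f u - f v.
Proof. by move=> fL; rewrite klinD // klinN. Qed.
Lemma klin_sum f (I : Type) (r : seq I) (P : pred I) (F : I -> V) :
  klinear f -> f (\sum_(i <- r | P i) F i) = \sum_(i <- r | P i) f (F i).
Proof. by move=> fL; apply: big_morph; [move=> u v; apply: klinD|apply: klin0]. Qed.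
End Closure.

Section Eval.
Variables (U V : lmodType K).

Definition teval (f : U -> V -> R) (d : tensor U V) : R :=
  tlift (f : U -> V -> scalars_via k) d.

Variable f : U -> V -> R.
Hypothesis fl : forall v, klinear (f^~ v).
Hypothesis fr : forall u, klinear (f u).
Let fbil : bilinear (f : U -> V -> scalars_via k).
Proof. by split=> [v|u]; [apply: fl|apply: fr]. Qed.

Lemma teval_tens u v : teval f (tens u v) = f u v.
Proof. exact: (tlift_tens fbil). Qed.
Lemma teval_klinear : klinear (teval f).
Proof. exact: (tlift_linear fbil). Qed.
End Eval.

Lemma tensor_kext (U V : lmodType K) (f g : tensor U V -> R) :
  klinear f -> klinear g -> (forall u v, f (tens u v) = g (tens u v)) -> f =1 g.
Proof.
move=> fL gL fg d; pattern d; apply: tensor_span; first by rewrite !klin0.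
by move=> c u v x IH; rewrite fL gL fg IH.
Qed.

Lemma tensor3_kext (U : lmodType K) (f g : tensor (tensor U U) U -> R) :
  klinear f -> klinear g ->
  (forall a b c, f (tens (tens a b) c) = g (tens (tens a b) c)) -> f =1 g.
Proof.
move=> fL gL fg; apply: tensor_kext => // d c; move: d.
have [tl _] := @tens_bilinear K (tensor U U) U.
by apply: tensor_kext => //; apply: (klinear_comp (g := fun d => tens d c)).
Qed.

End ScalarLinear.

Section RepAlgebra.
Variables (K : fieldType) (A : algType K) (n : nat) (e : 'I_n -> A).
Variable alpha : 'I_n -> nat.
Let N := (\sum_s alpha s)%N.
Variables (R : comPzRingType) (k : {rmorphism K -> R}) (x : A -> 'I_N -> 'I_N -> R).
Hypothesis xP : rep_algebra e k x.

Let x_lin i j : klinear k (fun a => x a i j).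
Proof. by move=> c a b; apply: (rep_lin xP). Qed.

Definition gen_mx (a : A) : 'M[R]_N := \matrix_(i, j) x a i j.
Local Notation X := gen_mx.

Lemma gen_mxE a i j : X a i j = x a i j.
Proof. by rewrite mxE. Qed.
Lemma gen_mx_lin c a b : X (c *: a + b) = k c *: X a + X b.
Proof. by apply/matrixP => i j; rewrite !mxE (rep_lin xP). Qed.
Lemma gen_mxM a b : X (a * b) = X a *m X b.
Proof.
apply/matrixP => i j; rewrite !mxE (rep_mul xP).
by apply: eq_bigr => r _; rewrite !mxE.
Qed.
Lemma gen_mx_idem s : X (e s) = \matrix_(i, j) ((blk i == s) && (i == j))%:R.
Proof. by apply/matrixP => i j; rewrite !mxE (rep_idem xP). Qed.

(* A derivation [D] of [R] amounts to the ring morphism [y |-> (y, D y)] into the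
   dual numbers over [R]. *)
Lemma rep_derivation (V : A -> 'M[R]_N) :
  (forall c a b, V (c *: a + b) = k c *: V a + V b) ->
  (forall a b, V (a * b) = V a *m X b + X a *m V b) ->
  (forall s, V (e s) = 0) ->
  exists D : R -> R, derivation_over k D /\ (forall a i j, D (x a i j) = V a i j).
Proof.
move=> VL VM Ve.
have [k0 k0E] := rmorphism_intro (@dual_cst_zmod_morphism R) (@dual_cst_monoid_morphism R).
pose Y a : 'M[dual_numbers R]_N := \matrix_(i, j) (x a i j, V a i j).
have [|||f [fc fx]] := @rep_lift _ _ _ _ _ _ _ _ xP _ (k0 \o k) Y.
- move=> c a b; apply/matrixP => i j; rewrite !mxE /= k0E dualM /= VL !mxE.
  by rewrite mul0r addr0 (rep_lin xP).
- move=> a b; apply/matrixP => i j; rewrite !mxE VM dual_sum /=; congr pair.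
    by rewrite (rep_mul xP); apply: eq_bigr => r _; rewrite !mxE.
  rewrite !mxE -big_split; apply: eq_bigr => r _ /=; rewrite !mxE /=.
  exact: addrC.
- move=> s; apply/matrixP => i j; rewrite !mxE Ve mxE (rep_idem xP).
  by case: (_ && _).
have f1 y : (f y).1 = y.
  elim/(rep_ind xP): y => [c|a i j|y z Ey Ez|y z Ey Ez].
  - by rewrite fc /= k0E.
  - by rewrite fx mxE.
  - by rewrite rmorphD /= Ey Ez.
  - by rewrite rmorphM /= Ey Ez.
exists (fun y => (f y).2); split; last by move=> a i j; rewrite fx mxE.
split=> [y z|y z|c]; first by rewrite rmorphB.
- by rewrite rmorphM dualM /= !f1 addrC.
- by rewrite fc /= k0E.
Qed.

Lemma rep_derivation_ext (D E : R -> R) :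
  derivation_over k D -> derivation_over k E ->
  (forall a i j, D (x a i j) = E (x a i j)) -> D =1 E.
Proof.
move=> dD dE DE; elim/(rep_ind xP) => [c|a i j|y z Ey Ez|y z Ey Ez].
- by rewrite (der_cst dD) (der_cst dE).
- exact: DE.
- by rewrite (derD dD) (derD dE) Ey Ez.
- by rewrite (derM dD) (derM dE) Ey Ez.
Qed.

Lemma rep_rmorph_ext (Q : comPzRingType) (f g : {rmorphism R -> Q}) :
  (forall c, f (k c) = g (k c)) ->
  (forall a i j, f (x a i j) = g (x a i j)) -> f =1 g.
Proof.
move=> fgc fgx; elim/(rep_ind xP) => [c|a i j|y z Ey Ez|y z Ey Ez] //.
- by rewrite !rmorphD Ey Ez.
- by rewrite !rmorphM Ey Ez.
Qed.

Definition tcoord (d : tensor A A) (k' j i l : 'I_N) : R :=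
  teval k (fun a b => x a k' j * x b i l) d.

Lemma tcoord_tens a b k' j i l : tcoord (tens a b) k' j i l = x a k' j * x b i l.
Proof.
by apply: teval_tens => ?; [apply: klinear_mulr|apply: klinear_mull].
Qed.
Lemma tcoord_lin k' j i l : klinear k (fun d => tcoord d k' j i l).
Proof.
by apply: teval_klinear => ?; [apply: klinear_mulr|apply: klinear_mull].
Qed.

Lemma tcoordD d d' k' j i l : tcoord (d + d') k' j i l = tcoord d k' j i l + tcoord d' k' j i l.
Proof. exact: (klinD _ _ (@tcoord_lin _ _ _ _)). Qed.
Lemma tcoordN d k' j i l : tcoord (- d) k' j i l = - tcoord d k' j i l.
Proof. exact: (klinN _ (@tcoord_lin _ _ _ _)). Qed.
Lemma tcoord0 k' j i l : tcoord 0 k' j i l = 0.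
Proof. exact: (klin0 (@tcoord_lin _ _ _ _)). Qed.

Lemma tcoord_swap d k' j i l : tcoord (tswap d) k' j i l = tcoord d i l k' j.
Proof.
move: d; apply: (tensor_kext (k := k)); last by move=> a b; rewrite tswap_tens !tcoord_tens mulrC.
- by apply: (klinear_comp (@tcoord_lin _ _ _ _)); apply: tswap_linear.
- exact: tcoord_lin.
Qed.

Let mulrL (a : A) : linear (fun b => a * b).
Proof. by move=> c b b'; rewrite mulrDr scalerAr. Qed.
Let mulrR (a : A) : linear (fun b => b * a).
Proof. by move=> c b b'; rewrite mulrDl scalerAl. Qed.

Lemma tcoord_outer1 d c k' j i l :
  tcoord (outer_act 1 d c) k' j i l = \sum_r tcoord d k' j i r * x c r l.
Proof.
move: d; apply: (tensor_kext (k := k)) => [||a b].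
- by apply: (klinear_comp (@tcoord_lin _ _ _ _)); apply: tmap_linear.
- by apply: klinear_sum => r; apply: klinear_mulr; apply: tcoord_lin.
rewrite /outer_act tmap_tens // mul1r tcoord_tens (rep_mul xP) mulr_sumr.
by apply: eq_bigr => r _; rewrite tcoord_tens mulrA.
Qed.

Lemma tcoord_outer2 d c k' j i l :
  tcoord (outer_act c d 1) k' j i l = \sum_r x c k' r * tcoord d r j i l.
Proof.
move: d; apply: (tensor_kext (k := k)) => [||a b].
- by apply: (klinear_comp (@tcoord_lin _ _ _ _)); apply: tmap_linear.
- by apply: klinear_sum => r; apply: klinear_mull; apply: tcoord_lin.
rewrite /outer_act tmap_tens // mulr1 tcoord_tens (rep_mul xP) mulr_suml.
by apply: eq_bigr => r _; rewrite tcoord_tens mulrA.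
Qed.

Lemma tcoord_inner1 d c k' j i l :
  tcoord (inner_act 1 d c) k' j i l = \sum_r tcoord d k' r i l * x c r j.
Proof.
move: d; apply: (tensor_kext (k := k)) => [||a b].
- by apply: (klinear_comp (@tcoord_lin _ _ _ _)); apply: tmap_linear.
- by apply: klinear_sum => r; apply: klinear_mulr; apply: tcoord_lin.
rewrite /inner_act tmap_tens // mul1r tcoord_tens (rep_mul xP) mulr_suml.
by apply: eq_bigr => r _; rewrite tcoord_tens mulrAC.
Qed.

Lemma tcoord_inner2 d c k' j i l :
  tcoord (inner_act c d 1) k' j i l = \sum_r x c i r * tcoord d k' j r l.
Proof.
move: d; apply: (tensor_kext (k := k)) => [||a b].
- by apply: (klinear_comp (@tcoord_lin _ _ _ _)); apply: tmap_linear.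
- by apply: klinear_sum => r; apply: klinear_mull; apply: tcoord_lin.
rewrite /inner_act tmap_tens // mulr1 tcoord_tens (rep_mul xP) mulr_sumr.
by apply: eq_bigr => r _; rewrite tcoord_tens mulrCA.
Qed.

Definition tcoord3 (z : tensor (tensor A A) A) (p j i l k' q : 'I_N) : R :=
  teval k (fun d c => tcoord d p j i l * x c k' q) z.

Lemma tcoord3_tens d c p j i l k' q :
  tcoord3 (tens d c) p j i l k' q = tcoord d p j i l * x c k' q.
Proof.
apply: teval_tens => ?; [apply: klinear_mulr; exact: tcoord_lin|].
by apply: klinear_mull.
Qed.
Lemma tcoord3_lin p j i l k' q : klinear k (fun z => tcoord3 z p j i l k' q).
Proof.
apply: teval_klinear => ?; [apply: klinear_mulr; exact: tcoord_lin|].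
by apply: klinear_mull.
Qed.

Lemma tcoord3_tau z p j i l k' q :
  tcoord3 (tau123 z) p j i l k' q = tcoord3 z i l k' q p j.
Proof.
move: z; apply: (tensor3_kext (k := k)) => [||a b c].
- by apply: (klinear_comp (@tcoord3_lin _ _ _ _ _ _)); apply: tau123_linear.
- exact: tcoord3_lin.
rewrite tau123_tens; apply: (etrans (tcoord3_tens _ _ _ _ _ _ _ _)); apply: esym.
apply: (etrans (tcoord3_tens _ _ _ _ _ _ _ _)).
by rewrite !tcoord_tens mulrC mulrA.
Qed.

Variable dbr : A -> A -> tensor A A.
Hypothesis hdbr : double_bracket e dbr.

Let dbr_l b : linear (dbr^~ b). Proof. exact: (dbr_bilinear hdbr).1. Qed.
Let dbr_r a : linear (dbr a). Proof. exact: (dbr_bilinear hdbr).2. Qed.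
Let A0e s : in_A0 e (e s).
Proof.
exists (fun t => (t == s)%:R); rewrite (bigD1 s) //= eqxx scale1r big1 ?addr0 //.
by move=> t /negbTE ->; rewrite scale0r.
Qed.

(** The bracket is extended one argument at a time. By the outer Leibniz rule each coordinate [a_ij]
    gives a derivation [D (a, i, j)] of [R]. For fixed [y], the inner Leibniz rule shows that the
    matrices with entries [D (a, i, j) y] obey the relations that define a derivation [E y]. *)
Lemma vdb_exists : exists pb : R -> R -> R,
  [/\ forall y, derivation_over k (pb y), forall y z, pb y z = - pb z y &
      forall a b i j k' l, pb (x a i j) (x b k' l) = tcoord (dbr a b) k' j i l].
Proof.
have Dx (p : A * 'I_N * 'I_N) : exists D : R -> R, derivation_over k D /\
    forall b k' l, D (x b k' l) = tcoord (dbr p.1.1 b) k' p.2 p.1.2 l.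
  case: p => -[a i] j /=.
  have [|||D [dD Dx]] := @rep_derivation
      (fun b => \matrix_(k', l) tcoord (dbr a b) k' j i l).
  - move=> c b b'; apply/matrixP => k' l; rewrite !mxE dbr_r.
    exact: tcoord_lin.
  - move=> b c; apply/matrixP => k' l; rewrite !mxE (dbr_outer_leibniz hdbr).
    apply: (etrans (tcoordD _ _ _ _ _ _)); congr (_ + _).
      by apply: (etrans (tcoord_outer1 _ _ _ _ _ _)); apply: eq_bigr => r _; rewrite !mxE.
    by apply: (etrans (tcoord_outer2 _ _ _ _ _ _)); apply: eq_bigr => r _; rewrite !mxE.
  - move=> s; apply/matrixP => k' l; rewrite !mxE.
    by rewrite (dbr_A0 hdbr a (A0e s)).2; apply: tcoord0.
  by exists D; split=> // b k' l; rewrite Dx mxE.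
have [D DP] := choice Dx.
have dD p : derivation_over k (D p) := (DP p).1.
have Dxx a i j b k' l : D (a, i, j) (x b k' l) = tcoord (dbr a b) k' j i l := (DP _).2 _ _ _.
have Ey (y : R) : exists E : R -> R, derivation_over k E /\
    forall a i j, E (x a i j) = D (a, i, j) y.
  have [|||E [dE Ex]] := @rep_derivation (fun a => \matrix_(i, j) D (a, i, j) y).
  (* Each relation required of [E] equates two derivations in [y], so it is enough to check it on
     coordinates. *)
  - move=> c a b; apply/matrixP => i j; rewrite !mxE; move: y.
    apply: rep_derivation_ext => //.
      split=> [y z|y z|c']; rewrite ?(derB (dD _)) ?(derM (dD _)) ?(der_cst (dD _)).
      - by ring. - by ring. - by rewrite mulr0 addr0.
    move=> b' k' l; rewrite !Dxx dbr_l; exact: tcoord_lin.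
  - move=> a b; apply/matrixP => i j.
    suff DM : D (a * b, i, j) =1 fun z =>
        \sum_r (D (a, i, r) z * x b r j + x a i r * D (b, r, j) z).
      by rewrite !mxE DM big_split; congr (_ + _); apply: eq_bigr => r _; rewrite !mxE.
    apply: rep_derivation_ext => //.
      split=> [z z'|z z'|c].
      - by rewrite -sumrB; apply: eq_bigr => r _; rewrite !(derB (dD _)); ring.
      - rewrite mulr_suml mulr_sumr -big_split /=; apply: eq_bigr => r _.
        by rewrite !(derM (dD _)); ring.
      - by apply: big1 => r _; rewrite !(der_cst (dD _)) mulr0 mul0r addr0.
    move=> c k' l; rewrite Dxx (dbr_inner_leibniz hdbr).
    apply: (etrans (tcoordD _ _ _ _ _ _)); rewrite big_split; congr (_ + _).
      apply: (etrans (tcoord_inner1 _ _ _ _ _ _)).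
      by apply: eq_bigr => r _; rewrite Dxx.
    apply: (etrans (tcoord_inner2 _ _ _ _ _ _)).
    by apply: eq_bigr => r _; rewrite Dxx.
  - move=> s; apply/matrixP => i j; rewrite !mxE; move: y.
    apply: (rep_derivation_ext (dD _) (derivation0 k)).
    by move=> b k' l; rewrite Dxx (dbr_A0 hdbr b (A0e s)).1; apply: tcoord0.
  by exists E; split=> // a i j; rewrite Ex mxE.
have [E EP] := choice Ey.
have dE y : derivation_over k (E y) := (EP y).1.
have Ex y a i j : E y (x a i j) = D (a, i, j) y := (EP y).2 _ _ _.
pose pb y z := E z y.
(* By construction [pb y z] is a derivation in [y]; that it is one in [z] is clear when [y] is a
   coordinate, and follows in general by induction on [y]. *)
have pb_der y : derivation_over k (pb y).
  rewrite /pb; elim/(rep_ind xP): y => [c|a i j|y z dy dz|y z dy dz].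
  - by split=> [u v|u v|c'] /=; rewrite !(der_cst (dE _)) ?subrr ?mul0r ?mulr0 ?addr0.
  - split=> [u v|u v|c'] /=; rewrite !Ex; [exact: derB|exact: derM|exact: der_cst].
  - split=> [u v|u v|c'] /=; rewrite !(derD (dE _)).
    + by rewrite (derB dy) (derB dz); ring.
    + by rewrite (derM dy) (derM dz); ring.
    + by rewrite (der_cst dy) (der_cst dz) addr0.
  - split=> [u v|u v|c'] /=; rewrite !(derM (dE _)).
    + by rewrite (derB dy) (derB dz); ring.
    + by rewrite (derM dy) (derM dz); ring.
    + by rewrite (der_cst dy) (der_cst dz) mulr0 mul0r addr0.
have pbx a b i j k' l : pb (x a i j) (x b k' l) = tcoord (dbr a b) k' j i l.
  by rewrite /pb Ex Dxx.
exists pb; split=> // y z; move: z.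
have dN (F : R -> R) : derivation_over k F -> derivation_over k (fun z => - F z).
  move=> dF; split=> [u v|u v|c] /=; rewrite ?(derB dF) ?(derM dF) ?(der_cst dF) ?oppr0 //; ring.
apply: (rep_derivation_ext (pb_der y) (dN _ (dE y))) => b k' l; move: y.
apply: (rep_derivation_ext (dE _) (dN _ (pb_der _))) => a i j.
rewrite -/(pb _ _) !pbx (dbr_cyclic_antisym hdbr) tcoordN.
by rewrite tcoord_swap.
Qed.

End RepAlgebra.

(** * Jacobi identity, symmetries and moment map of Van den Bergh's bracket *)

Section DerivationMore.
Variables (R : comPzRingType) (K : Type) (k : K -> R).

Lemma derivation_comm (D E : R -> R) : derivation_over k D -> derivation_over k E ->
  derivation_over k (fun y => D (E y) - E (D y)).
Proof.
move=> dD dE; split=> [y z|y z|c].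
- by rewrite (derB dD) (derB dE) (derB dD) (derB dE); ring.
- rewrite (derM dD) (derM dE) (derD dD) (derD dE) !(derM dD) !(derM dE); ring.
- by rewrite (der_cst dD) (der_cst dE) (der0 dD) (der0 dE) subrr.
Qed.

Lemma derivation_conj (D : R -> R) (f : {rmorphism R -> R}) :
  involutive f -> (forall c, f (k c) = k c) -> derivation_over k D ->
  derivation_over k (fun y => f (D (f y))).
Proof.
move=> fK fk dD; split=> [y z|y z|c].
- by rewrite rmorphB (derB dD) rmorphB.
- by rewrite rmorphM (derM dD) rmorphD !rmorphM !fK.
- by rewrite fk (der_cst dD) rmorph0.
Qed.

Lemma der_sign (D : R -> R) (b : bool) y : derivation_over k D -> D ((-1) ^+ b * y) = (-1) ^+ b * D y.
Proof.
by move=> dD; case: b; rewrite ?mul1r // !mulN1r (derN dD).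
Qed.

End DerivationMore.

Section BlockIdempotents.
Variables (n : nat) (alpha : 'I_n -> nat) (Q : comPzRingType).
Let N := (\sum_s alpha s)%N.

Definition block_id s : 'M[Q]_N := \matrix_(i, j) ((blk i == s) && (i == j))%:R.

Lemma mul_block_id s (M : 'M[Q]_N) i j : (block_id s *m M) i j = (blk i == s)%:R * M i j.
Proof.
rewrite mxE (bigD1 i) //= big1 => [|r r_i]; first by rewrite mxE eqxx andbT addr0.
by rewrite mxE [i == r]eq_sym (negbTE r_i) andbF mul0r.
Qed.

Lemma mul_mx_block_id s (M : 'M[Q]_N) i j : (M *m block_id s) i j = (blk j == s)%:R * M i j.
Proof.
rewrite mxE (bigD1 j) //= big1 => [|r r_j]; first by rewrite mxE eqxx andbT addr0 mulrC.
by rewrite mxE (negbTE r_j) andbF mulr0.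
Qed.

Lemma block_id_comm s (M : 'M[Q]_N) : block_diag M -> block_id s *m M = M *m block_id s.
Proof.
move=> MD; apply/matrixP => i j; rewrite mul_block_id mul_mx_block_id.
by have [->|ij] := eqVneq (blk i) (blk j); rewrite // MD // !mulr0.
Qed.

End BlockIdempotents.

Lemma map_block_diag n (alpha : 'I_n -> nat) (Q Q' : comPzRingType) (f : {rmorphism Q -> Q'})
    (M : 'M[Q]_(\sum_s alpha s)%N) : block_diag M -> block_diag (map_mx f M).
Proof. by move=> MD i j ij; rewrite mxE MD // rmorph0. Qed.

Section VanDenBergh.
Variables (K : fieldType) (A : algType K) (n : nat) (e : 'I_n -> A).
Variable alpha : 'I_n -> nat.
Let N := (\sum_s alpha s)%N.
Variables (R : comPzRingType) (k : {rmorphism K -> R}) (x : A -> 'I_N -> 'I_N -> R).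
Hypothesis xP : rep_algebra e k x.
Variable dbr : A -> A -> tensor A A.
Hypothesis hdbr : double_bracket e dbr.
Variable pb : R -> R -> R.
Hypothesis pb_der : forall y, derivation_over k (pb y).
Hypothesis pb_anti : forall y z, pb y z = - pb z y.
Local Notation tc := (tcoord k x).
Local Notation tc3 := (tcoord3 k x).
Local Notation X := (gen_mx x).
Hypothesis pbx : forall a b i j k' l, pb (x a i j) (x b k' l) = tc (dbr a b) k' j i l.

Let pbl_der y : derivation_over k (pb^~ y).
Proof.
have dN := derivationB (derivation0 k) (pb_der y).
by split=> [u v|u v|c] /=; rewrite !(pb_anti _ y) ?(derB (pb_der y)) ?(derM (pb_der y))
  ?(der_cst (pb_der y)) ?oppr0 //; ring.
Qed.

Let dbr_r a : linear (dbr a). Proof. exact: (dbr_bilinear hdbr).2. Qed.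

Lemma dbrL_linear a : linear (dbrL dbr a).
Proof. by apply: tmap_linear => //; apply: linear_id. Qed.

(** The Leibniz rule differentiates both factors of a product of coordinates, whereas [dbrL] acts on
    the left leg only; the second leg is reached by swapping. *)
Lemma vdb_tcoord a i j d p l k' q : pb (x a i j) (tc d p l k' q) =
  tc3 (dbrL dbr a d) p j i l k' q + tc3 (dbrL dbr a (tswap d)) k' j i q p l.
Proof.
move: d; apply: (tensor_kext (k := k)).
- by apply: klinear_der => //; apply: tcoord_lin xP _ _ _ _.
- apply: klinear_add.
    by apply: (klinear_comp (tcoord3_lin xP _ _ _ _ _ _)); apply: dbrL_linear.
  apply: (klinear_comp (tcoord3_lin xP _ _ _ _ _ _)).
  by apply: linear_comp; [apply: dbrL_linear|apply: tswap_linear].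
move=> b c; rewrite (tcoord_tens xP) (derM (pb_der _)) !pbx tswap_tens.
rewrite /dbrL !tmap_tens //; congr (_ + _).
  by apply: esym; apply: (etrans (tcoord3_tens xP _ _ _ _ _ _ _ _)).
by apply: esym; apply: (etrans (tcoord3_tens xP _ _ _ _ _ _ _ _)); rewrite mulrC.
Qed.

(* The Jacobi identity as [ad_y ad_z - ad_z ad_y = ad_{y,z}]: both sides are
   derivations in [u], and the statement is symmetric in [y], [z], [u]. *)
Let Q y z u := pb y (pb z u) - pb z (pb y u) = pb (pb y z) u.

Let Q_swap12 y z u : Q y z u -> Q z y u.
Proof. by rewrite /Q => yz; rewrite [pb z y]pb_anti (derN (pbl_der u)) -yz opprB. Qed.

Let Q_swap23 y z u : Q y z u -> Q y u z.
Proof.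
rewrite /Q => yz; rewrite [pb (pb y u) z]pb_anti [pb y (pb u z)](congr1 _ (pb_anti _ _)).
rewrite (derN (pb_der y)) [pb u _]pb_anti -yz; ring.
Qed.

Let Q_ext y z : (forall a i j, Q y z (x a i j)) -> forall u, Q y z u.
Proof.
by move=> H; apply: (rep_derivation_ext xP); [apply: derivation_comm|apply: pb_der|].
Qed.

(** On coordinates each iterated bracket gives two terms by [vdb_tcoord], and cyclic antisymmetry
    makes the swapped one negative. The positive terms add up to the triple bracket of [a], [b],
    [c], the negative ones to that of [a], [c], [b]. *)
Lemma vdb_jacobi : double_poisson dbr ->
  forall y z u, pb y (pb z u) + pb z (pb u y) + pb u (pb y z) = 0.
Proof.
move=> hP y z u; suff: Q y z u.
  rewrite /Q [pb u (pb y z)]pb_anti => <-.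
  by rewrite [pb u y]pb_anti (derN (pb_der z)); ring.
(* [Q_ext] extends in the last argument only, so each argument in turn is brought there by the two
   transpositions. *)
suff Qx a i j b k' l c p q : Q (x a i j) (x b k' l) (x c p q).
  apply: (Q_ext _) => c p q; apply: Q_swap23; apply: Q_swap12.
  apply: (Q_ext _) => b k' l; apply: Q_swap23.
  by apply: (Q_ext _) => a i j.
have tswap_dbr a' b' : tswap (dbr a' b') = - dbr b' a'.
  by rewrite (dbr_cyclic_antisym hdbr b' a') opprK.
have dL a' b' c' p' j' i' l' k'' q' : tc3 (dbrL dbr a' (tswap (dbr b' c'))) p' j' i' l' k'' q' =
    - tc3 (dbrL dbr a' (dbr c' b')) p' j' i' l' k'' q'.
  rewrite tswap_dbr; apply: (etrans (congr1 (fun z => tc3 z _ _ _ _ _ _) (linN _ (dbrL_linear _)))).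
  exact: (klinN _ (tcoord3_lin xP _ _ _ _ _ _)).
have tr a' b' c' i' j' k'' l' p' q' :
    tc3 (dbrL dbr a' (dbr b' c')) p' j' i' l' k'' q' +
    tc3 (dbrL dbr b' (dbr c' a')) i' l' k'' q' p' j' +
    tc3 (dbrL dbr c' (dbr a' b')) k'' q' p' j' i' l' = 0.
  have /(congr1 (fun z => tc3 z p' j' i' l' k'' q')) := hP a' b' c'.
  have tD := klinD _ _ (tcoord3_lin xP p' j' i' l' k'' q').
  move=> E; apply: (etrans _ (etrans E _)); last exact: klin0 (tcoord3_lin xP _ _ _ _ _ _).
  apply: esym; apply: (etrans (tD _ _)); congr (_ + _).
    apply: (etrans (tD _ _)); congr (_ + _).
    exact: (tcoord3_tau xP).
  by apply: (etrans (tcoord3_tau xP _ _ _ _ _ _ _)); apply: (tcoord3_tau xP).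
have pb2 a' i' j' b' k'' l' c' p' q' : pb (x a' i' j') (pb (x b' k'' l') (x c' p' q')) =
    tc3 (dbrL dbr a' (dbr b' c')) p' j' i' l' k'' q' -
    tc3 (dbrL dbr a' (dbr c' b')) k'' j' i' q' p' l'.
  by rewrite pbx vdb_tcoord; congr (_ + _); apply: dL.
have add3 (u1 u2 u3 v1 v2 v3 : R) : u1 + u2 + u3 = 0 -> v1 + v2 + v3 = 0 ->
    (u1 - v1) + (u2 - v3) + (u3 - v2) = 0.
  by move=> Eu Ev; rewrite -[RHS](subrr 0) -{1}Eu -Ev; ring.
have J : pb (x a i j) (pb (x b k' l) (x c p q)) + pb (x b k' l) (pb (x c p q) (x a i j)) +
   pb (x c p q) (pb (x a i j) (x b k' l)) = 0.
  apply: (etrans (congr2 _ (congr2 _ (pb2 _ _ _ _ _ _ _ _ _) (pb2 _ _ _ _ _ _ _ _ _))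
                           (pb2 _ _ _ _ _ _ _ _ _))).
  exact: (add3 _ _ _ _ _ _ (tr a b c i j k' l p q) (tr a c b i j p q k' l)).
rewrite /Q; move: J; rewrite [pb (x c p q) (x a i j)]pb_anti (derN (pb_der _)).
by rewrite [pb (x c p q) _]pb_anti => /eqP; rewrite subr_eq0 => /eqP.
Qed.

Lemma bracket_morph (f : {rmorphism R -> R}) : (forall c, f (k c) = k c) ->
  (forall a b i j k' l, f (pb (x a i j) (x b k' l)) = pb (f (x a i j)) (f (x b k' l))) ->
  forall y z, f (pb y z) = pb (f y) (f z).
Proof.
move=> fk fx y; elim/(rep_ind xP) => [c|b k' l|u v Eu Ev|u v Eu Ev].
- by rewrite fk !(der_cst (pb_der _)) rmorph0.
- elim/(rep_ind xP): y => [c|a i j|u v Eu Ev|u v Eu Ev].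
  + by rewrite fk !(der_cst (pbl_der _)) rmorph0.
  + exact: fx.
  + by rewrite (derD (pbl_der _)) !rmorphD (derD (pbl_der _)) Eu Ev.
  + by rewrite (derM (pbl_der _)) rmorphD !rmorphM (derM (pbl_der _)) Eu Ev.
- by rewrite (derD (pb_der _)) !rmorphD (derD (pb_der _)) Eu Ev.
- by rewrite (derM (pb_der _)) rmorphD !rmorphM (derM (pb_der _)) Eu Ev.
Qed.

Section Conjugation.
Variables (g h : 'M[K]_N).
Hypotheses (gD : block_diag g) (hD : block_diag h) (gh : g *m h = 1%:M) (hg : h *m g = 1%:M).

(** Block-diagonality of [h] makes it commute with the block idempotents, which preserves the
    relation for [e s]. *)
Lemma conj_exists : exists f : {rmorphism R -> R},
  (forall c, f (k c) = k c) /\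
  forall a, map_mx f (X a) = map_mx k h *m X a *m map_mx k g.
Proof.
have kgh : map_mx k g *m map_mx k h = 1%:M by rewrite -map_mxM gh map_mx1.
have khg : map_mx k h *m map_mx k g = 1%:M by rewrite -map_mxM hg map_mx1.
have [|||f [fk fx]] := @rep_lift _ _ _ _ _ _ _ _ xP R k
    (fun a => map_mx k h *m X a *m map_mx k g).
- by move=> c a b; rewrite (gen_mx_lin xP) mulmxDr mulmxDl -scalemxAr -scalemxAl.
- move=> a b; rewrite (gen_mxM xP) !mulmxA; congr (_ *m _ *m _).
  by rewrite -(mulmxA _ (map_mx k g)) kgh mulmx1.
- move=> s; rewrite (gen_mx_idem xP) -/(block_id _ _ s) -block_id_comm.
    by rewrite -mulmxA khg mulmx1.
  exact: map_block_diag.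
by exists f; split=> // a; apply/matrixP => i j; rewrite -fx !mxE.
Qed.

Variable f : {rmorphism R -> R}.
Hypothesis fk : forall c, f (k c) = k c.
Hypothesis fX : forall a, map_mx f (X a) = map_mx k h *m X a *m map_mx k g.

Let fx a i j : f (x a i j) = \sum_p \sum_q k (h i p * g q j) * x a p q.
Proof.
have /matrixP/(_ i j) := fX a; rewrite !mxE => ->; rewrite exchange_big /=.
apply: eq_bigr => q _; rewrite !mxE mulr_suml; apply: eq_bigr => p _.
by rewrite !mxE rmorphM mulrAC.
Qed.

Let f_tc d k' j i l : f (tc d k' j i l) =
  \sum_p \sum_q \sum_r \sum_s k (h k' p * g q j * (h i r * g s l)) * tc d p q r s.
Proof.
move: d; apply: (tensor_kext (k := k)).
- by apply: klinear_rmorph => //; apply: tcoord_lin xP _ _ _ _.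
- do 4![apply: klinear_sum => ?]; apply: klinear_mull; exact: tcoord_lin xP _ _ _ _.
move=> b c; rewrite (tcoord_tens xP) rmorphM !fx mulr_suml; apply: eq_bigr => p _.
rewrite mulr_suml; apply: eq_bigr => q _; rewrite mulr_sumr; apply: eq_bigr => r _.
rewrite mulr_sumr; apply: eq_bigr => s _; rewrite (tcoord_tens xP) !rmorphM; ring.
Qed.

(** In the bracket formula [i], [k'] remain row indices and [j], [l] column indices, so both sides
    are transformed by [h] in the former and by [g] in the latter; the rest reorders the four
    sums. *)
Lemma conj_bracket y z : f (pb y z) = pb (f y) (f z).
Proof.
apply: bracket_morph => // a b i j k' l; rewrite pbx f_tc !fx.
rewrite (der_sum (pb_der _)); apply: eq_bigr => p _.
rewrite (der_sum (pb_der _)).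
under eq_bigr => q _ do rewrite exchange_big.
rewrite exchange_big; apply: eq_bigr => s _.
rewrite (derZ (pb_der _)) (der_sum (pbl_der _)) mulr_sumr exchange_big /=.
apply: eq_bigr => r _; rewrite (der_sum (pbl_der _)) mulr_sumr.
by apply: eq_bigr => q _; rewrite (derZ (pbl_der _)) pbx !rmorphM; ring.
Qed.

End Conjugation.

Section InfinitesimalConjugation.
Variable xi : 'M[K]_N.
Hypothesis xiD : block_diag xi.

Lemma inf_exists : exists D : R -> R, derivation_over k D /\
  forall a i j, D (x a i j) = (X a *m map_mx k xi - map_mx k xi *m X a) i j.
Proof.
apply: (rep_derivation xP).
- move=> c a b; rewrite (gen_mx_lin xP) mulmxDl mulmxDr -scalemxAl -scalemxAr.
  by rewrite scalerBr opprD addrACA.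
- by move=> a b; rewrite (gen_mxM xP) mulmxBl mulmxBr !mulmxA [RHS]addrC addrA subrK.
- move=> s; rewrite (gen_mx_idem xP) -/(block_id _ _ s) block_id_comm ?subrr //.
  exact: map_block_diag.
Qed.

(** Summing the moment map identity over [s] gives Kronecker symbols restricted to pairs of indices
    in one block. Contracted with [xi] they yield the commutator, since [xi] has no entries outside
    these blocks. *)
Lemma vdb_moment mu (D : R -> R) : derivation_over k D ->
  (forall a i j, D (x a i j) = (X a *m map_mx k xi - map_mx k xi *m X a) i j) ->
  double_moment_map e dbr mu ->
  forall y, pb (\tr (X mu *m map_mx k xi)) y = D y.
Proof.
move=> dD Dx [mu_ [Emu _ hmu]]; apply: (rep_derivation_ext xP) => // b k' l.
have tmu i j : tc (dbr mu b) k' j i l =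
    x b k' j * ((i == l) && (blk j == blk l))%:R - ((k' == j) && (blk i == blk k'))%:R * x b i l.
  have E : dbr mu b = \sum_s (tens (b * e s) (e s) - tens (e s) (e s * b)).
    rewrite Emu (lin_sum (f := dbr^~ b)) ?hmu; last exact: (dbr_bilinear hdbr).1.
    by apply: eq_bigr => s _; rewrite hmu.
  rewrite E; apply: (etrans (klin_sum _ _ _ (tcoord_lin xP _ _ _ _))).
  have Es s : tc (tens (b * e s) (e s) - tens (e s) (e s * b)) k' j i l =
     (blk j == s)%:R * x b k' j * ((blk i == s) && (i == l))%:R -
     ((blk k' == s) && (k' == j))%:R * ((blk i == s)%:R * x b i l).
    apply: (etrans (klinB _ _ (tcoord_lin xP _ _ _ _))).
    have xbe u v : x (b * e s) u v = (blk v == s)%:R * x b u v.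
      have /matrixP/(_ u v) := gen_mxM xP b (e s); rewrite mxE => ->.
      by rewrite (gen_mx_idem xP) mul_mx_block_id mxE.
    have xeb u v : x (e s * b) u v = (blk u == s)%:R * x b u v.
      have /matrixP/(_ u v) := gen_mxM xP (e s) b; rewrite mxE => ->.
      by rewrite (gen_mx_idem xP) mul_block_id mxE.
    by congr (_ - _); apply: (etrans (tcoord_tens xP _ _ _ _ _ _));
      rewrite ?xbe ?xeb !(rep_idem xP).
  rewrite (eq_bigr _ (fun s _ => Es s)) sumrB; congr (_ - _).
    rewrite (bigD1 (blk j)) //= [X in _ + X]big1 => [|s /negbTE]; last first.
      by rewrite eq_sym => ->; rewrite !mul0r.
    rewrite eqxx mul1r addr0; congr (_ * _).
    by case: (i =P l) => [->|_]; rewrite ?andbF // andbT [blk l == _]eq_sym.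
  rewrite (bigD1 (blk i)) //= [X in _ + X]big1 => [|s /negbTE]; last first.
    by rewrite eq_sym => ->; rewrite mul0r mulr0.
  rewrite eqxx mul1r addr0; congr (_ * _).
  by rewrite andbC [blk i == _]eq_sym.
rewrite Dx; transitivity (\sum_i \sum_j pb (X mu i j * map_mx k xi j i) (x b k' l)).
  apply: (etrans (der_sum (pbl_der _) _ _ _)); apply: eq_bigr => i _; rewrite mxE.
  exact: (der_sum (pbl_der _)).
have Eij i j : pb (X mu i j * map_mx k xi j i) (x b k' l) =
   x b k' j * ((i == l) && (blk j == blk l))%:R * k (xi j i) -
   ((k' == j) && (blk i == blk k'))%:R * (x b i l * k (xi j i)).
  by rewrite !mxE mulrC (derZ (pbl_der _)) pbx tmu; ring.
apply: (etrans (eq_bigr _ (fun i _ => etrans (eq_bigr _ (fun j _ => Eij i j))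
  (sumrB _ _ _ _)))).
apply: (etrans (sumrB _ _ _ _)); rewrite !mxE; congr (_ - _).
  rewrite exchange_big; apply: eq_bigr => j _; rewrite (bigD1 l) //= [X in _ + X]big1 => [|i /negbTE ->].
    rewrite eqxx !mxE addr0 /=; have [_|jl] := eqVneq (blk j) (blk l); first by rewrite mulr1.
    by rewrite xiD // (rmorph0 k) !mulr0.
  by rewrite mulr0 mul0r.
apply: eq_bigr => i _; rewrite (bigD1 k') //= [X in _ + X]big1 => [|j /negbTE].
  rewrite eqxx !mxE addr0 /= eq_sym; have [_|ki] := eqVneq (blk k') (blk i).
    by rewrite mul1r mulrC.
  by rewrite xiD // (rmorph0 k) !(mulr0, mul0r).
by rewrite eq_sym => ->; rewrite mul0r.
Qed.

End InfinitesimalConjugation.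

Section Involution.
Variables (ty : 'I_n -> block_type) (w : A -> A).
Hypothesis halpha : typed_dimension ty alpha.
Hypothesis hw : typed_anti_involution e ty w.
Hypothesis hdbrw : typed_double_bracket w dbr.
Local Notation th := (theta ty).
Local Notation adj := (theta_adj ty).
Local Notation low := (lower ty).

(* [sigma] transposes by [Theta _ Theta^T], which is inverse to the map
   [Theta^T _ Theta] appearing in [trep_rel]. *)
Lemma sigma_exists : exists f : {rmorphism R -> R},
  (forall c, f (k c) = k c) /\ forall a, map_mx f (X a) = adj (X (w a)).
Proof.
have adjZ c (M : 'M[R]_N) : adj (c *: M) = c *: adj M.
  by rewrite /theta_adj linearZ /= -scalemxAr -scalemxAl.
have [|||f [fk fx]] := @rep_lift _ _ _ _ _ _ _ _ xP R k (fun a => adj (X (w a))).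
- by move=> c a b; rewrite (tai_linear hw) (gen_mx_lin xP) theta_adjD adjZ.
- by move=> a b; rewrite (tai_antimorph hw) (gen_mxM xP) theta_adjM.
- move=> s; rewrite (tai_idem hw) (gen_mx_idem xP); apply/matrixP => i j.
  rewrite theta_adjE // !mxE blk_theta (inj_eq (inv_inj (thetaK halpha))) [j == i]eq_sym.
  have [->|_] := eqVneq i j; last by rewrite !andbF mulr0.
  by rewrite -expr2 sqrr_sign mul1r.
by exists f; split=> // a; apply/matrixP => i j; rewrite -fx !mxE.
Qed.

Variable sg : {rmorphism R -> R}.
Hypothesis sgk : forall c, sg (k c) = k c.
Hypothesis sgX : forall a, map_mx sg (X a) = adj (X (w a)).

Lemma sigma_x a i j : sg (x a i j) = (-1) ^+ low i * (-1) ^+ low j * x (w a) (th j) (th i).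
Proof. by have /matrixP/(_ i j) := sgX a; rewrite theta_adjE // !mxE. Qed.

Lemma sigma_x' a i j : sg (x a i j) = k (sgn2 K ty (th i) (th j)) * x (w a) (th j) (th i).
Proof. by rewrite sigma_x sgn2_theta // rmorphM !rmorph_sign. Qed.

Let x_block a i j : x (e (blk i) * a * e (blk j)) i j = x a i j.
Proof.
rewrite -(gen_mxE x (_ * _)) -(gen_mxE x a) !(gen_mxM xP) !(gen_mx_idem xP).
by rewrite mul_mx_block_id mul_block_id !eqxx !mul1r.
Qed.

Lemma x_ww a i j : x (w (w a)) i j =
  k (type_sign K (ty (blk i)) * type_sign K (ty (blk j))) * x a i j.
Proof.
rewrite -[LHS]x_block -[in RHS](x_block a).
have -> : e (blk i) * w (w a) * e (blk j) = w (w (e (blk i) * a * e (blk j))).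
  by rewrite !(tai_antimorph hw) !(tai_idem hw).
have xZ c b : x (c *: b) i j = k c * x b i j.
  have := rep_lin xP c b 0 i j; rewrite addr0 => ->.
  by rewrite (klin0 (k := k) (fun c a b => rep_lin xP c a b i j)) addr0.
by rewrite (tai_square hw) xZ.
Qed.

(** The type signs produced by transposing twice are cancelled by those of [w (w a)]. *)
Lemma sigmaK : involutive sg.
Proof.
move=> y; apply: (rep_rmorph_ext xP (f := sg \o sg) (g := idfun)) => [c|a i j] /=.
  by rewrite !sgk.
rewrite [in LHS]sigma_x' rmorphM sgk sigma_x' x_ww !thetaK // !mulrA -!rmorphM.
suff -> : sgn2 K ty (th i) (th j) * sgn2 K ty j i *
    (type_sign K (ty (blk i)) * type_sign K (ty (blk j))) = 1 by rewrite rmorph1 mul1r.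
have -> : sgn2 K ty j i = sgn2 K ty i j by rewrite /sgn2 mulrC.
rewrite [X in X * _]mulrC (sgn2_thetaK halpha) /type_sign.
by do 2!case: is_Sp; rewrite ?expr0 ?expr1 ?(mulrN1, mulN1r, mulr1, mul1r, opprK).
Qed.

Let sg_tc d k' j i l : sg (tc d k' j i l) =
  (-1) ^+ low k' * (-1) ^+ low j * ((-1) ^+ low i * (-1) ^+ low l) *
  tc (tmap w w d) (th j) (th k') (th l) (th i).
Proof.
have wl := tai_linear hw.
move: d; apply: (tensor_kext (k := k)).
- by apply: klinear_rmorph => //; apply: tcoord_lin xP _ _ _ _.
- apply: klinear_mull; apply: (klinear_comp (tcoord_lin xP _ _ _ _)).
  exact: tmap_linear.
move=> b c; rewrite tmap_tens // !(tcoord_tens xP) rmorphM !sigma_x.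
by rewrite mulrACA.
Qed.

(** Transposition exchanges row and column indices in each leg and applies [w] to both legs.
    Typedness rewrites the result as a swapped bracket, and undoing the swap restores the index
    pattern of the bracket of the transposed coordinates. *)
Lemma sigma_bracket y z : sg (pb y z) = pb (sg y) (sg z).
Proof.
apply: bracket_morph => // a b i j k' l; rewrite pbx sg_tc (hdbrw a b).
rewrite !sigma_x -!mulrA !(der_sign _ _ (pb_der _)) !(der_sign _ _ (pbl_der _)) pbx.
rewrite !mulrA; apply: (etrans (congr1 ( *%R _) (tcoord_swap xP _ _ _ _ _))).
by move: ((-1) ^+ low i) ((-1) ^+ low j) ((-1) ^+ low k') ((-1) ^+ low l) => *; ring.
Qed.

(** The adjoint reverses products and inverts [g], so it carries a conjugation by [g] to the same
    conjugation. *)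
Lemma sigma_conj (g : 'M[K]_N) (f : {rmorphism R -> R}) : in_G ty g ->
  (forall c, f (k c) = k c) ->
  (forall a, map_mx f (X a) = map_mx k (invmx g) *m X a *m map_mx k g) ->
  forall y, f (sg y) = sg (f y).
Proof.
move=> gG fk fX; apply: (rep_rmorph_ext xP (f := f \o sg) (g := sg \o f)) => [c|a i j] /=.
  by rewrite !(sgk, fk).
have mk (s : {rmorphism R -> R}) (M : 'M[K]_N) : (forall c, s (k c) = k c) ->
    map_mx s (map_mx k M) = map_mx k M.
  by move=> sk; apply/matrixP => u v; rewrite !mxE sk.
suff /matrixP/(_ i j) : map_mx f (map_mx sg (X a)) = map_mx sg (map_mx f (X a)).
  by rewrite !mxE.
rewrite fX !map_mxM !mk // sgX map_theta_adj // fX !theta_adjM // mulmxA.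
by rewrite -!map_theta_adj // theta_adjV // -in_G_inv.
Qed.

Lemma sigma_inf (xi : 'M[K]_N) (D : R -> R) : in_Lie ty xi -> derivation_over k D ->
  (forall a i j, D (x a i j) = (X a *m map_mx k xi - map_mx k xi *m X a) i j) ->
  forall y, D (sg y) = sg (D y).
Proof.
move=> /(theta_adj_in_Lie halpha) [xiD xiT] dD Dx y.
(* [D] composed with [sg] is not a derivation in general, but its conjugate by the involution [sg]
   is one and can be compared with [D] on coordinates. *)
have dD' := derivation_conj sigmaK sgk dD.
suff E : (fun y => sg (D (sg y))) =1 D by rewrite -[RHS](congr1 sg (E y)) sigmaK.
apply: (rep_derivation_ext xP) => // a i j.
have Dadj : D (sg (x a i j)) = adj (X (w a) *m map_mx k xi - map_mx k xi *m X (w a)) i j.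
  by rewrite theta_adjE // sigma_x -!mulrA !(der_sign _ _ dD) Dx.
have mk (M : 'M[K]_N) : map_mx sg (map_mx k M) = map_mx k M.
  by apply/matrixP => u v; rewrite !mxE sgk.
have sgsgX : map_mx sg (map_mx sg (X a)) = X a.
  by apply/matrixP => u v; rewrite !mxE sigmaK.
have E : adj (X (w a) *m map_mx k xi - map_mx k xi *m X (w a)) =
    map_mx sg (X a) *m map_mx k xi - map_mx k xi *m map_mx sg (X a).
  rewrite theta_adjD theta_adjN !theta_adjM // -map_theta_adj // xiT map_mxN.
  by rewrite mulmxN mulNmx opprK addrC sgX.
rewrite Dadj E Dx.
have -> : forall M : 'M[R]_N, sg (M i j) = map_mx sg M i j by move=> M; rewrite mxE.
by rewrite map_mxB !map_mxM !mk sgsgX.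
Qed.

(** Both [mu] under [w] and [xi] under the adjoint change sign; the two signs cancel, and the trace
    is invariant under transposition. *)
Lemma sigma_moment (xi : 'M[K]_N) mu : in_Lie ty xi -> mu + w mu = 0 ->
  sg (\tr (X mu *m map_mx k xi)) = \tr (X mu *m map_mx k xi).
Proof.
move=> /(theta_adj_in_Lie halpha) [xiD xiT] muw.
have wmu : w mu = - mu by apply/eqP; rewrite -addr_eq0 addrC muw.
have XN a : X (- a) = - X a.
  by apply/matrixP => i j; rewrite !mxE (klinN (k := k) _ (fun c a b => rep_lin xP c a b i j)).
have mk (M : 'M[K]_N) : map_mx sg (map_mx k M) = map_mx k M.
  by apply/matrixP => u v; rewrite !mxE sgk.
rewrite -(trace_map_mx sg) map_mxM mk sgX wmu XN theta_adjN mulNmx.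
have CT : (Theta_mx ty alpha R)^T *m map_mx k xi *m Theta_mx ty alpha R = - (map_mx k xi)^T.
  have := map_theta_adj ty k xi; rewrite xiT map_mxN => /eqP; rewrite eqr_oppLR.
  move=> /eqP E; rewrite {1}E mulmxN mulNmx /theta_adj !mulmxA Theta_mulVK // mul1mx.
  by rewrite -mulmxA Theta_mulVK // mulmx1.
rewrite linearN /= /theta_adj -!mulmxA mxtrace_mulC -mulmxA CT.
by rewrite mulmxN linearN /= opprK -trmx_mul mxtrace_tr mxtrace_mulC.
Qed.

End Involution.
End VanDenBergh.

Lemma half_add_half (K : fieldType) : (2%:R : K) != 0 -> 2%:R^-1 + 2%:R^-1 = 1 :> K.
Proof. by move=> K2; rewrite -mulr2n -[LHS]mulr_natl divff. Qed.

(** * Normalising moment maps *)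

Section MomentShift.
Variables (K : fieldType) (A : algType K) (n : nat) (e : 'I_n -> A).
Variables (ty : 'I_n -> block_type) (w : A -> A) (dbr : A -> A -> tensor A A).
Hypothesis K2 : (2%:R : K) != 0.
Hypothesis he : idempotent_decomposition e.
Hypothesis hw : typed_anti_involution e ty w.
Hypothesis hdbr : double_bracket e dbr.
Hypothesis hdbrw : typed_double_bracket w dbr.

Let dbr_l b : linear (dbr^~ b). Proof. exact: (dbr_bilinear hdbr).1. Qed.
Let dbr_r a : linear (dbr a). Proof. exact: (dbr_bilinear hdbr).2. Qed.

Lemma idempotent_mul s : e s * e s = e s.
Proof. by rewrite he.1 eqxx. Qed.

Lemma in_A0_scale c s : in_A0 e (c *: e s).
Proof.
exists (fun t => if t == s then c else 0); rewrite (bigD1 s) //= eqxx.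
rewrite [X in _ + X]big1 ?addr0 // => t /negbTE ->; exact: scale0r.
Qed.

(* Pairing [m + w m] with [m] in both orders gives
   [(m + w m) (x) e_s = e_s (x) (m + w m)]. *)
Lemma moment_casimir s m : m = e s * m * e s ->
  (forall a, dbr m a = tens (a * e s) (e s) - tens (e s) (e s * a)) ->
  exists c, m + w m = c *: e s.
Proof.
(* If [e s] vanishes then so does [m]; [tens_comm] covers only the nonzero case. *)
move=> Em hm; have [e0|e0] := eqVneq (e s) 0.
  exists 0; rewrite e0 scaler0 Em e0 !mul0r (lin0 (tai_linear hw)) addr0 //.
have me : m * e s = m by rewrite Em -!mulrA idempotent_mul.
have em : e s * m = m by rewrite Em !mulrA idempotent_mul.
have wme : w m * e s = w m by rewrite -{1}(tai_idem hw s) -(tai_antimorph hw) em.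
have ewm : e s * w m = w m by rewrite -{1}(tai_idem hw s) -(tai_antimorph hw) me.
have wwm : w (w m) = m.
  rewrite Em (tai_square hw) -[RHS]scale1r; congr (_ *: _).
  by rewrite /type_sign -expr2 sqrr_sign.
have d1 : dbr m (w m) = tens (w m) (e s) - tens (e s) (w m) by rewrite hm wme ewm.
have d2 : dbr m m = tens m (e s) - tens (e s) m by rewrite hm me em.
(* As [w (w m) = m], typedness expresses this bracket through [dbr m (w m)], which [d1] computes. *)
have d3 : dbr (w m) m = tens (e s) m - tens m (e s).
  have wL := tai_linear hw.
  rewrite -{2}wwm -[LHS]tswapK -hdbrw d1 (linB _ _ (tmap_linear wL wL)) !tmap_tens //.
  by rewrite wwm (tai_idem hw) (linB _ _ (@tswap_linear _ _ _)) !tswap_tens.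
have d4 : dbr (m + w m) m = 0.
  by rewrite (linD (f := dbr^~ m)) // d2 d3 addrC addrA subrK subrr.
have : dbr m (m + w m) = 0.
  by rewrite (dbr_cyclic_antisym hdbr) d4 (lin0 (@tswap_linear _ _ _)) oppr0.
rewrite hm mulrDl mulrDr me em wme ewm => /subr0_eq E.
exact: tens_comm E e0.
Qed.

Lemma moment_map_shift mu : double_moment_map e dbr mu ->
  exists c : A, [/\ in_A0 e c, double_moment_map e dbr (mu + c) &
                   (mu + c) + w (mu + c) = 0].
Proof.
move=> [mu_ [Emu Ems hmu]].
have /choice[c cP] s : exists c, mu_ s + w (mu_ s) = c *: e s.
  exact: moment_casimir (Ems s) (hmu s).
(* [w] fixes [e s], so adding [d s *: e s] to [mu_ s] changes [mu_ s + w (mu_ s)] by twice that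
   amount. *)
pose d s := - (c s / 2%:R).
exists (\sum_s d s *: e s); split; first by exists d.
- exists (fun s => mu_ s + d s *: e s); split=> [|s|s a].
  + by rewrite Emu big_split.
  + by rewrite mulrDr mulrDl -Ems -scalerAr -scalerAl !idempotent_mul.
  + rewrite (linD (f := dbr^~ a)) // hmu (dbr_A0 hdbr a (in_A0_scale _ _)).1.
    by rewrite addr0.
have wL := tai_linear hw.
rewrite Emu -big_split (lin_sum _ _ _ wL) -big_split; apply: big1 => s _ /=.
rewrite (linD _ _ wL) (linZ _ _ wL) (tai_idem hw) addrACA cP -!scalerDl.
suff -> : c s + (d s + d s) = 0 by rewrite scale0r.
by rewrite -opprD -mulrDr half_add_half // mulr1 subrr.
Qed.

End MomentShift.

(** * Descent to the typed representation space *)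

Section Descent.
Variables (K : fieldType) (A : algType K) (n : nat) (e : 'I_n -> A).
Variables (ty : 'I_n -> block_type) (alpha : 'I_n -> nat) (w : A -> A).
Variable dbr : A -> A -> tensor A A.
Let N := (\sum_s alpha s)%N.
Variables (R : comPzRingType) (k : {rmorphism K -> R}) (x : A -> 'I_N -> 'I_N -> R).
Variable S : R -> Prop.
Hypothesis K2 : (2%:R : K) != 0.
Hypothesis xP : rep_algebra e k x.
Hypothesis halpha : typed_dimension ty alpha.
Hypothesis hw : typed_anti_involution e ty w.
Hypothesis hdbr : double_bracket e dbr.
Hypothesis hdbrw : typed_double_bracket w dbr.
Hypothesis hdbrP : double_poisson dbr.
Hypothesis SP : forall s, S s <-> exists a i j,
  s = x (w a) i j - k (sgn2 K ty i j) * x a (theta ty j) (theta ty i).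
Local Notation T := (ideal_quot S).
Local Notation pi := (ipi S).
Local Notation tc := (tcoord k x).
Local Notation X := (gen_mx x).

Lemma quot_ind (P : T -> Prop) :
  (forall c, P (pi (k c))) -> (forall a i j, P (pi (x a i j))) ->
  (forall y z, P y -> P z -> P (y + z)) -> (forall y z, P y -> P z -> P (y * z)) ->
  forall y, P y.
Proof.
move=> Pk Px PD PM y; have [{}y ->] := ipiP y.
elim/(rep_ind xP): y => // y z Py Pz; rewrite ?ipiD ?ipiM; [exact: PD|exact: PM].
Qed.

Lemma quot_derivation_ext (D E : T -> T) :
  derivation_over (fun c => pi (k c)) D -> derivation_over (fun c => pi (k c)) E ->
  (forall a i j, D (pi (x a i j)) = E (pi (x a i j))) -> D =1 E.
Proof.
move=> dD dE DE; elim/quot_ind => [c|a i j|y z Ey Ez|y z Ey Ez].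
- by rewrite (der_cst dD) (der_cst dE).
- exact: DE.
- by rewrite (derD dD) (derD dE) Ey Ez.
- by rewrite (derM dD) (derM dE) Ey Ez.
Qed.

Lemma quot_bracket_ext (p q : T -> T -> T) :
  (forall y, derivation_over (fun c => pi (k c)) (p y)) ->
  (forall y, derivation_over (fun c => pi (k c)) (q y)) ->
  (forall y z, p y z = - p z y) -> (forall y z, q y z = - q z y) ->
  (forall a b i j k' l, p (pi (x a i j)) (pi (x b k' l)) = q (pi (x a i j)) (pi (x b k' l))) ->
  forall y z, p y z = q y z.
Proof.
move=> dp dq pA qA pq y; apply: (quot_derivation_ext (dp y) (dq y)) => b k' l.
rewrite pA qA; congr (- _); move: y.
by apply: quot_derivation_ext => // a i j; rewrite pA qA pq.
Qed.

Section Involution.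
Variable sg : {rmorphism R -> R}.
Hypothesis sgk : forall c, sg (k c) = k c.
Hypothesis sgX : forall a, map_mx sg (X a) = theta_adj ty (X (w a)).

(** With [u] a coordinate of [w a], [sg u] involves [w (w a)], whose type signs turn [sgn2] at the
    indices [theta i], [theta j] into [sgn2] at [i], [j]. *)
Lemma quot_rel s : S s -> exists u, s = u - sg u.
Proof.
move=> /SP [a [i [j ->]]]; exists (x (w a) i j); congr (_ - _).
rewrite (sigma_x' k halpha sgX) (x_ww xP hw) !blk_theta mulrA -rmorphM.
rewrite [type_sign _ _ * _]mulrC -(sgn2_thetaK halpha) mulrCA.
by rewrite sgn2_theta_sqr // mulr1.
Qed.

Lemma quot_sigma u : pi (sg u) = pi u.
Proof.
elim/(rep_ind xP): u => [c|a i j|y z Ey Ez|y z Ey Ez].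
- by rewrite sgk.
- rewrite (sigma_x' k halpha sgX) ipiM.
  have /subr0_eq -> : pi (x (w a) (theta ty j) (theta ty i)) -
      pi (k (sgn2 K ty (theta ty j) (theta ty i)) * x a i j) = 0.
    rewrite -ipiB; apply/ipi0P/ideal_gen_gen/SP.
    by exists a, (theta ty j), (theta ty i); rewrite !thetaK.
  rewrite -ipiM mulrA -rmorphM [sgn2 K ty (theta ty j) _]sgn2C.
  by rewrite sgn2_theta_sqr // rmorph1 mul1r.
- by rewrite rmorphD !ipiD Ey Ez.
- by rewrite rmorphM !ipiM Ey Ez.
Qed.

Lemma quot_rmorph (f : {rmorphism R -> R}) : (forall y, f (sg y) = sg (f y)) ->
  exists g : {rmorphism T -> T}, forall y, g (pi y) = pi (f y).
Proof.
move=> fsg; apply: (ideal_quot_rlift (f := ipi S \o f)) => s /quot_rel [u ->] /=.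
by rewrite rmorphB fsg ipiB quot_sigma subrr.
Qed.

Lemma quot_derivation (D : R -> R) : derivation_over k D ->
  (forall y, D (sg y) = sg (D y)) ->
  exists E : T -> T, derivation_over (fun c => pi (k c)) E /\ forall y, E (pi y) = pi (D y).
Proof.
move=> dD Dsg.
have [||E EP] := @ideal_quot_lift _ S _ (fun y => pi (D y)).
- by move=> y z; rewrite (derB dD) ipiB.
- move=> c s /quot_rel [u ->]; rewrite (derM dD) ipiD !ipiM (derB dD) Dsg !ipiB.
  by rewrite !quot_sigma !subrr !mulr0 addr0.
exists E; split=> //; split=> [y z|y z|c].
- by have [[{}y ->] [{}z ->]] := (ipiP y, ipiP z); rewrite -ipiB !EP (derB dD) ipiB.
- have [[{}y ->] [{}z ->]] := (ipiP y, ipiP z).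
  by rewrite -ipiM !EP (derM dD) ipiD !ipiM.
- by rewrite EP (der_cst dD) ipi0.
Qed.

End Involution.

(** All the mathematical content of the result, with scalars written [pi (k c)]; what is left
    afterwards is a translation to the module structure of [trep_ring]. *)
Lemma rep_descent : exists (pb : T -> T -> T) (act inf : 'M[K]_N -> T -> T),
  [/\ poisson_over (fun c => pi (k c)) pb,
      forall a b i j k' l, pb (pi (x a i j)) (pi (x b k' l)) =
        pi (k 2%:R^-1) * pi (tc (dbr a b) k' j i l) +
        pi (k (2%:R^-1 * sgn2 K ty (theta ty i) (theta ty j))) *
          pi (tc (dbr (w a) b) k' (theta ty i) (theta ty j) l),
      [/\ forall g, in_G ty g -> zmod_morphism (act g),
          forall g, in_G ty g -> monoid_morphism (act g),
          forall g, in_G ty g -> forall c, act g (pi (k c)) = pi (k c),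
          forall g, in_G ty g -> forall a i j, act g (pi (x a i j)) =
            pi ((map_mx k (invmx g) *m X a *m map_mx k g) i j) &
          [/\ forall y, act 1%:M y = y,
              forall g h, in_G ty g -> in_G ty h ->
                forall y, act (g *m h) y = act g (act h y) &
              forall g, in_G ty g -> forall y z, act g (pb y z) = pb (act g y) (act g z)]],
      [/\ forall xi, in_Lie ty xi -> derivation_over (fun c => pi (k c)) (inf xi) &
          forall xi, in_Lie ty xi -> forall a i j, inf xi (pi (x a i j)) =
            pi ((X a *m map_mx k xi - map_mx k xi *m X a) i j)] &
      forall mu, double_moment_map e dbr mu -> mu + w mu = 0 ->
        [/\ block_diag (map_mx pi (X mu)),
            theta_adj ty (map_mx pi (X mu)) = - map_mx pi (X mu),
            forall g xi, in_G ty g -> in_Lie ty xi ->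
              act g (pi (\tr (X mu *m map_mx k xi))) =
              pi (\tr (X mu *m map_mx k (g *m xi *m invmx g))) &
            forall xi, in_Lie ty xi -> forall y,
              pb (pi (\tr (X mu *m map_mx k xi))) y = inf xi y]].
Proof.
have [pb0 [pb0_der pb0_anti pb0x]] := vdb_exists xP hdbr.
have [sg [sgk sgX]] := sigma_exists xP halpha hw.
have sK := sigmaK xP halpha hw sgk sgX.
have sgpb := sigma_bracket xP pb0_der pb0_anti pb0x hw hdbrw sgk sgX.
have jac := vdb_jacobi xP hdbr pb0_der pb0_anti pb0x hdbrP.
have pb0P : poisson_over k pb0 by [].
have h2 : k 2%:R^-1 + k 2%:R^-1 = 1.
  by rewrite -rmorphD half_add_half // rmorph1.
have Srel := quot_rel sgX; have pisg := quot_sigma sgk sgX.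
pose pb : T -> T -> T := dirac_bracket k pb0 sg 2%:R^-1.
have pbP : poisson_over (fun c => pi (k c)) pb by apply: dirac_poisson.
have pbE y z : sg y = y -> pb (pi y) (pi z) = pi (pb0 y z) by apply: dirac_bracketE.
have pbpi y z : pb (pi y) (pi z) = pi (pb0 (k 2%:R^-1 * (y + sg y)) z).
  exact: dirac_bracket_pi.
(* The action must be a function of all matrices; outside G it is set to the identity, a junk value,
   and likewise below for [D] and [inf] outside the Lie algebra. *)
have /choice[f fP] (g : 'M[K]_N) : exists f : {rmorphism R -> R}, in_G ty g ->
    (forall c, f (k c) = k c) /\
    forall a, map_mx f (X a) = map_mx k (invmx g) *m X a *m map_mx k g.
  have [gG|gNG] := pselect (in_G ty g); last by exists idfun.
  have [hD _] := (in_GP halpha _).1 (in_GV halpha gG).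
  have gU := in_G_unit halpha gG.
  by have [f fP] := conj_exists xP hD (mulmxV gU) (mulVmx gU); exists f.
have fsg g (gG : in_G ty g) y : f g (sg y) = sg (f g y).
  by have [fk fX] := fP _ gG; apply: (sigma_conj xP halpha sgk sgX gG fk fX).
have fx g (gG : in_G ty g) a i j : f g (x a i j) =
    (map_mx k (invmx g) *m X a *m map_mx k g) i j.
  by rewrite -(fP _ gG).2 !mxE.
have f1 y : f 1%:M y = y.
  have [fk fX] := fP _ (in_G1 halpha K); move: y.
  apply: (rep_rmorph_ext xP (g := idfun)) => [c|a i j] /=; first by rewrite fk.
  by rewrite (fx _ (in_G1 halpha K)) invmx1 !map_mx1 mul1mx mulmx1 mxE.
have fM g h : in_G ty g -> in_G ty h -> forall y, f (g *m h) y = f g (f h y).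
  move=> gG hG; have ghG := in_GM halpha gG hG.
  have [[gk gX] [hk hX]] := (fP _ gG, fP _ hG); have [ghk ghX] := fP _ ghG.
  apply: (rep_rmorph_ext xP (g := f g \o f h)) => [c|a i j] /=.
    by rewrite ghk hk gk.
  have mk (M : 'M[K]_N) : map_mx (f g) (map_mx k M) = map_mx k M.
    by apply/matrixP => u v; rewrite !mxE gk.
  suff /matrixP/(_ i j) : map_mx (f (g *m h)) (X a) = map_mx (f g) (map_mx (f h) (X a)).
    by rewrite !mxE.
  rewrite ghX hX !map_mxM !mk gX.
  have -> : invmx (g *m h) = invmx h *m invmx g.
    by rewrite !(in_G_inv halpha) // theta_adjM.
  by rewrite !map_mxM !mulmxA.
have /choice[act actP] (g : 'M[K]_N) : exists a : {rmorphism T -> T}, in_G ty g ->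
    forall y, a (pi y) = pi (f g y).
  have [gG|gNG] := pselect (in_G ty g); last by exists idfun.
  by have [a aP] := quot_rmorph sgk sgX (fsg _ gG); exists a.
have /choice[D DP] (xi : 'M[K]_N) : exists D : R -> R, in_Lie ty xi ->
    derivation_over k D /\
    forall a i j, D (x a i j) = (X a *m map_mx k xi - map_mx k xi *m X a) i j.
  have [xiL|xiNL] := pselect (in_Lie ty xi); last by exists id.
  have [xiD _] := (in_LieP halpha xi).1 xiL.
  by have [D DP] := inf_exists xP xiD; exists D.
have /choice[inf infP] (xi : 'M[K]_N) : exists E : T -> T, in_Lie ty xi ->
    derivation_over (fun c => pi (k c)) E /\ forall y, E (pi y) = pi (D xi y).
  have [xiL|xiNL] := pselect (in_Lie ty xi); last by exists id.
  have [dD Dx] := DP _ xiL.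
  have Dsg := sigma_inf xP halpha hw sgk sgX xiL dD Dx.
  by have [E EP] := quot_derivation sgk sgX dD Dsg; exists E.
exists pb, (fun g => act g), inf; split=> //.
- move=> a b i j k' l; rewrite pbpi.
  rewrite pb0_anti (derZ (pb0_der _)) (derD (pb0_der _)) mulrDr opprD -!mulrN -!pb0_anti.
  rewrite pb0x (sigma_x' k halpha sgX) pb0_anti (derZ (pb0_der _)) -mulrN -pb0_anti pb0x.
  by rewrite ipiD mulrA -rmorphM !ipiM.
- split; last split.
  + by move=> g _; apply: rmorphB.
  + by move=> g _; split; [apply: rmorph1|apply: rmorphM].
  + by move=> g gG c; rewrite actP // (fP _ gG).1.
  + by move=> g gG a i j; rewrite actP // fx.
  + by move=> y; have [{}y ->] := ipiP y; rewrite actP ?f1 //; apply: in_G1.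
  + move=> g h gG hG y; have [{}y ->] := ipiP y.
    by rewrite !actP ?fM //; apply: in_GM.
  + move=> g gG y z; have [[{}y ->] [{}z ->]] := (ipiP y, ipiP z).
    (* [f g] commutes with [sg], hence with averaging, so the invariance of [pb0] passes to the
       reduced bracket. *)
    rewrite pbpi !actP // pbpi -fsg // -rmorphD.
    have [fk fX] := fP _ gG.
    by rewrite (conj_bracket xP pb0_der pb0_anti pb0x fk fX) rmorphM fk.
- split=> xi xiL; first exact: (infP _ xiL).1.
  by move=> a i j; rewrite (infP _ xiL).2 (DP _ xiL).2.
move=> mu hmu muw; split.
(* Each [mu_ s] lies in the corner cut out by [e s], so its coordinates outside block [s] vanish. *)
- apply: map_block_diag; case: hmu => mu_ [-> hmu _] i j ij.
  rewrite mxE (klin_sum (k := k) _ _ _ (fun c a b => rep_lin xP c a b i j)).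
  apply: big1 => s _; rewrite hmu -(gen_mxE x) !(gen_mxM xP) !(gen_mx_idem xP).
  rewrite mul_mx_block_id mul_block_id.
  have [<-|_] := eqVneq (blk j) s; last by rewrite mul0r.
  by rewrite (negbTE ij) mul0r mulr0.
- have wmu : w mu = - mu by apply/eqP; rewrite -addr_eq0 addrC muw.
  have XN a : X (- a) = - X a.
    by apply/matrixP => i j; rewrite !mxE (klinN (k := k) _ (fun c a b => rep_lin xP c a b i j)).
  (* A coordinate and its image under [sg] agree in the quotient, and [w mu = - mu] turns this into
     the Lie algebra condition. *)
  suff E : map_mx pi (X mu) = - theta_adj ty (map_mx pi (X mu)) by rewrite {2}E opprK.
  transitivity (map_mx pi (map_mx sg (X mu))).
    by apply/matrixP => i j; rewrite !mxE pisg.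
  by rewrite sgX wmu XN theta_adjN map_mxN map_theta_adj.
- move=> g xi gG xiL; rewrite actP // -trace_map_mx map_mxM (fP _ gG).2.
  have -> : map_mx (f g) (map_mx k xi) = map_mx k xi.
    by apply/matrixP => u v; rewrite !mxE (fP _ gG).1.
  by rewrite !map_mxM -!mulmxA mxtrace_mulC !mulmxA.
- move=> xi xiL y; have [{}y ->] := ipiP y.
  have [dD Dx] := DP _ xiL; have [xiD _] := (in_LieP halpha xi).1 xiL.
  (* The Hamiltonian is [sg]-invariant, so its reduced bracket is the class of the bracket
     upstairs. *)
  rewrite pbE ?(infP _ xiL).2.
    by rewrite (vdb_moment xP hdbr pb0_der pb0_anti pb0x xiD dD Dx hmu).
  exact: (sigma_moment xP halpha sgk sgX xiL muw).
Qed.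

End Descent.

(** * The coordinate ring of the typed representation space and the final assembly *)

Section TypedRep.
Variables (K : fieldType) (A : algType K) (n : nat) (e : 'I_n -> A).
Variables (ty : 'I_n -> block_type) (alpha : 'I_n -> nat) (w : A -> A).
Let N := (\sum_s alpha s)%N.
Local Notation R := (rep_ring e alpha).
Local Notation T := (trep_ring e alpha ty w).
Local Notation x := (@rep_coord K A n e alpha).
Local Notation pi := (ipi (@trep_rel K A n e alpha ty w)).
Local Notation cst := (rep_cst e alpha).
Local Notation tX := (trep_X e alpha ty w).

Lemma trep_scaleE c (y : T) : c *: y = pi (cst c) * y.
Proof. by []. Qed.

Lemma trep_XE a i j : tX a i j = pi (x a i j).
Proof. by rewrite mxE. Qed.

Variable k : {rmorphism K -> R}.
Hypothesis kE : k =1 cst.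

Lemma rep_ring_algebra : rep_algebra e k x.
Proof. by rewrite (funext kE : (k : K -> R) = cst); apply: rep_ringP. Qed.

Lemma trep_X_klin i j : klinear (trep_cst e alpha ty w) (fun a => tX a i j).
Proof.
move=> c a b; apply: (etrans (trep_XE _ _ _)).
apply: (etrans (congr1 pi (rep_coord_linear e c a b i j))).
apply: (etrans (ipiD _ _ _)); apply: (congr2 +%R); last exact: (esym (trep_XE _ _ _)).
apply: (etrans (ipiM _ _ _)); apply: (congr1 ( *%R _)); exact: (esym (trep_XE _ _ _)).
Qed.

Lemma tensor_coordE d k' j i l :
  tensor_coord e ty w d k' j i l = pi (tcoord k x d k' j i l).
Proof.
have bil : bilinear (fun c d => tX c k' j * tX d i l : T).
  by split=> [a|a]; [exact: (klinear_mulr (tX a i l) (trep_X_klin k' j))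
                    |exact: (klinear_mull (tX a k' j) (trep_X_klin i l))].
have piZ c (u v : R) : pi (k c * u + v) = pi (cst c) * pi u + pi v.
  by rewrite ipiD ipiM kE.
pose f d := tensor_coord e ty w d k' j i l; pose g d := pi (tcoord k x d k' j i l).
suff fg : f =1 g by apply: fg.
apply: (@tensor_kext K T (trep_cst e alpha ty w) A A f g) => [|c u v|a b].
- exact: (tlift_linear bil).
- apply: (etrans (congr1 pi (tcoord_lin rep_ring_algebra k' j i l c u v))).
  exact: piZ.
- apply: (etrans (tlift_tens bil a b)).
  apply: (etrans (congr2 *%R (trep_XE _ _ _) (trep_XE _ _ _))).
  apply: (etrans (esym (ipiM _ _ _))); apply: (congr1 pi).
  by apply: esym; apply: (tcoord_tens rep_ring_algebra).
Qed.

Lemma trep_relP s : trep_rel ty w s <-> exists a i j,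
  s = x (w a) i j - k (sgn2 K ty i j) * x a (theta ty j) (theta ty i).
Proof.
split=> [[a i j]|[a [i [j ->]]]]; first by exists a, i, j; rewrite kE.
by rewrite kE; constructor.
Qed.

Lemma trep_X_map a : tX a = map_mx pi (gen_mx x a).
Proof. by apply/matrixP => i j; rewrite !mxE. Qed.

Lemma cst_mx_map (M : 'M[K]_N) : cst_mx e ty w M = map_mx pi (map_mx k M).
Proof. by apply/matrixP => i j; rewrite !mxE kE. Qed.

Lemma trace_pairingE mu xi :
  trace_pairing (tX mu) xi = pi (\tr (gen_mx x mu *m map_mx k xi)).
Proof. by rewrite /trace_pairing trep_X_map cst_mx_map -map_mxM trace_map_mx. Qed.

(** A linear map obeying the Leibniz rule kills constants because [D 1 = D 1 + D 1]. *)
Lemma derivation_linear (D : T -> T) :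
  derivation_over (fun c => pi (k c)) D <-> linear D /\ forall y z, D (y * z) = D y * z + y * D z.
Proof.
split=> [dD|[DL DM]].
  split=> [c y z|]; last exact: derM dD.
  by rewrite !trep_scaleE -kE (derD dD) (derZ dD).
split=> // [y z|c]; first exact: linB DL.
have D1 : D 1 = 0.
  have := DM 1 1; rewrite !mulr1 mul1r => D11.
  by apply: (addrI (D 1)); rewrite addr0.
have := @linZ K T T D c 1 DL; rewrite D1 scaler0 => <-.
by rewrite trep_scaleE mulr1 kE.
Qed.

Variable dbr : A -> A -> tensor A A.
Hypothesis K2 : (2%:R : K) != 0.
Hypothesis he : idempotent_decomposition e.
Hypothesis hw : typed_anti_involution e ty w.
Hypothesis hdbr : double_bracket e dbr.
Hypothesis hdbrw : typed_double_bracket w dbr.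
Hypothesis hdbrP : double_poisson dbr.
Hypothesis halpha : typed_dimension ty alpha.

(** Holds over any field in which 2 is invertible, as the averaging over [sigma] and the shift of
    [mu] demand. *)
Theorem typed_rep_poisson :
  exists (pb : T -> T -> T) (act inf : 'M[K]_N -> T -> T),
    [/\ poisson_bracket pb,
        rep_bracket_formula dbr pb,
        (forall pb', antisym_biderivation pb' -> rep_bracket_formula dbr pb' ->
           forall x y, pb' x y = pb x y),
        G_action act /\ G_invariant act pb &
        [/\ infinitesimal_action inf,
            (forall mu : A, double_moment_map e dbr mu ->
               exists c : A, [/\ in_A0 e c, double_moment_map e dbr (mu + c) &
                                 (mu + c) + w (mu + c) = 0]) &
            (forall mu : A, double_moment_map e dbr mu -> mu + w mu = 0 ->
               in_Lie ty (tX mu) /\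
               moment_map act inf pb (trace_pairing (tX mu)))]].
Proof.
have xP := rep_ring_algebra.
have [pb [act [inf [pbP pbx [actB actM actk actx [act1 actC actpb]] [infD infx] hmm]]]] :=
  rep_descent K2 xP halpha hw hdbr hdbrw hdbrP trep_relP.
have pbF : rep_bracket_formula dbr pb.
  move=> a b i j k' l; apply: (etrans (congr2 pb (trep_XE _ _ _) (trep_XE _ _ _))).
  apply: (etrans (pbx _ _ _ _ _ _)); apply: (congr2 +%R).
    exact: (congr2 *%R (congr1 pi (kE _)) (esym (tensor_coordE _ _ _ _ _))).
  exact: (congr2 *%R (congr1 pi (kE _)) (esym (tensor_coordE _ _ _ _ _))).
have pbA : antisym_biderivation pb.
  split; first split=> [y|y].
  - have dN := derivationB (derivation0 _) (pois_der pbP y).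
    have [L _] := (derivation_linear _).1 dN.
    by move=> c u v; have := L c u v; rewrite !sub0r -!(pois_anti pbP).
  - exact: ((derivation_linear _).1 (pois_der pbP y)).1.
  - exact: pois_anti pbP.
  - by move=> y; apply: (derM (pois_der pbP y)).
have uniq pb' : antisym_biderivation pb' -> rep_bracket_formula dbr pb' ->
    forall y z, pb' y z = pb y z.
  move=> pbA' pbF'; apply: (quot_bracket_ext xP) => [y|y|||a b i j k' l].
  - apply/derivation_linear; split; first exact: (pb_bilinear pbA').2.
    exact: pb_leibniz pbA' y.
  - exact: pois_der pbP y.
  - exact: pb_antisym pbA'.
  - exact: pois_anti pbP.
  - have E p : p (tX a i j) (tX b k' l) = p (pi (x a i j)) (pi (x b k' l)) :> T.
      exact: (congr2 p (trep_XE _ _ _) (trep_XE _ _ _)).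
    by rewrite -[LHS]E -[RHS]E pbF pbF'.
have actP : G_action act.
  split=> // [g gG c y z|g gG a i j].
    have [f fE] := rmorphism_intro (actB g gG) (actM g gG).
    have fc : f (pi (cst c)) = pi (cst c) by rewrite fE -kE actk.
    rewrite -!fE; apply: (etrans (rmorphD f _ _)); apply: (congr2 +%R) => //.
    exact: (etrans (rmorphM f _ y) (congr1 ( *%R^~ (f y)) fc)).
  apply: (etrans (congr1 (act g) (trep_XE _ _ _))); apply: (etrans (actx g gG a i j)).
  by rewrite !cst_mx_map trep_X_map -!map_mxM [RHS]mxE.
exists pb, act, inf; split=> //.
- by split=> //; apply: pois_jacobi pbP.
- split; first split=> xi xiL.
  + exact: ((derivation_linear _).1 (infD _ xiL)).1.
  + exact: ((derivation_linear _).1 (infD _ xiL)).2.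
  + move=> a i j; apply: (etrans (congr1 (inf xi) (trep_XE _ _ _))).
    apply: (etrans (infx xi xiL a i j)).
    by rewrite !cst_mx_map trep_X_map -!map_mxM -map_mxB [RHS]mxE.
  + exact: (moment_map_shift K2 he hw hdbr hdbrw).
  + move=> mu hmu muw; have [XD XT Xact Xinf] := hmm mu hmu muw; split.
      by rewrite trep_X_map; apply/(theta_adj_in_Lie halpha).
    split=> [c xi eta xiL etaL|g xi gG xiL|xi xiL y].
    - by rewrite /trace_pairing /cst_mx map_mxD map_mxZ mulmxDr -scalemxAr linearD linearZ.
    - by rewrite !trace_pairingE; apply: Xact.
    - by rewrite trace_pairingE; apply: Xinf.
Qed.

End TypedRep.

Theorem theorem5p11 (R : realType) (A : algType R[i]) (n : nat) (e : 'I_n -> A)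
    (ty : 'I_n -> block_type) (w : A -> A) (dbr : A -> A -> tensor A A)
    (alpha : 'I_n -> nat)
    (hA : finitely_generated A)
    (he : idempotent_decomposition e)
    (hw : typed_anti_involution e ty w)
    (hdbr : double_bracket e dbr)
    (hdbrw : typed_double_bracket w dbr)
    (hdbrP : double_poisson dbr)
    (halpha : typed_dimension ty alpha) :
  exists (pb : trep_ring e alpha ty w -> trep_ring e alpha ty w -> trep_ring e alpha ty w)
         (act inf : 'M[R[i]]_(\sum_s alpha s)%N ->
                    trep_ring e alpha ty w -> trep_ring e alpha ty w),
    [/\ poisson_bracket pb,
        rep_bracket_formula dbr pb,
        (forall pb', antisym_biderivation pb' -> rep_bracket_formula dbr pb' ->
           forall x y, pb' x y = pb x y),
        G_action act /\ G_invariant act pb &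
        [/\ infinitesimal_action inf,
            (forall mu : A, double_moment_map e dbr mu ->
               exists c : A, [/\ in_A0 e c, double_moment_map e dbr (mu + c) &
                                 (mu + c) + w (mu + c) = 0]) &
            (forall mu : A, double_moment_map e dbr mu -> mu + w mu = 0 ->
               in_Lie ty (trep_X e alpha ty w mu) /\
               moment_map act inf pb (trace_pairing (trep_X e alpha ty w mu)))]].
Proof.
have [k kE] := rep_cst_rmorphism e alpha.
by apply: (typed_rep_poisson kE) => //; rewrite Num.Theory.pnatr_eq0.
Qed.
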